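(* Consider a feedforward network and assume bifurcation assumption (B) with non-maximal critical cells (so $K=\sum_{\sigma\in\Sigma}a_\sigma\ne0$). Let $B\subset C$ be a root subnetwork for which real non-zero coefficients $(D_p)_{p\in C}$ can be defined recursively along $\trianglelefteq$ by the following rules (with $A_p:=\sum_{\sigma,\tau\in\mathcal L_p}f_{\sigma\tau}$): - $p\in B$: $D_p=-\ell/K$; - $p\notin B$ non-critical, $\mu_p=0$: $D_p=-\bigl(\sum_{\tau\notin\mathcal L_p}a_\tau D_{\tau(p)}+\ell\bigr)/\sum_{\sigma\in\mathcal L_p}a_\sigma$; - $p\notin B$ non-critical, $\mu_p>0$: $D_p=-\bigl(\sum_{\tau:\tau(p)\in\mathbf Q_p}a_\tau D_{\tau(p)}\bigr)/\sum_{\sigma\in\mathcal L_p}a_\sigma$; - $p\notin B$ critical, $\mu_p=0$: $D_p=\frac{\ell}{K}\bigl(1+2\frac{\sum_{\sigma\in\mathcal L_p,\tau\notin\mathcal L_p}f_{\sigma\tau}}{A_p}\bigr)-\frac{\sum_{\sigma\in\mathcal L_p}f_{\sigma\lambda}}{A_p}$; - $p$ critical, $\mu_p=1$: $D_p=\pm\sqrt{-\bigl(\sum_{\tau\notin\mathcal L_p}a_\tau D_{\tau(p)}+\ell\bigr)/A_p}$; - $p$ critical, $\mu_p>1$: $D_p=\pm\sqrt{-\bigl(\sum_{\tau:\tau(p)\in\mathbf Q_p}a_\tau D_{\tau(p)}\bigr)/A_p}$, such that (for the chosen signs) the inequalities $$\frac{\sum_{\tau\notin\mathcal L_p}a_\tau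 D_{\tau(p)}+\ell}{A_p}<0\ \text{for critical $p$ with }\mu_p=1,\qquad \frac{\sum_{\tau:\tau(p)\in\mathbf Q_p}a_\tau D_{\tau(p)}}{A_p}<0\ \text{for critical $p$ with }\mu_p>1$$ hold. Then there is a branch of steady states of $\gamma_f(x,\lambda)=0$ with $$x_p(\lambda)=X(\lambda)=D_p\lambda+O(|\lambda|^2)\ \ (p\in B),\qquad x_p(\lambda)=D_p\lambda^{2^{-\mu_p}}+O\bigl(|\lambda|^{2^{-(\mu_p-1)}}\bigr)\ \ (p\notin B)$$ for small $\lambda>0$. In particular the cells in $B$ are synchronous, following $X(\lambda)$, and the cells not in $B$ are not synchronous with those in $B$.
   Context: Network: finite cells $C$, pairwise distinct maps $\Sigma=\{\sigma_1,\dots,\sigma_n\}$, $\sigma_i\colon C\to C$, $\sigma_1=\mathrm{Id}_C$; arrow of type $\sigma$ from $q$ to $p$ iff $\sigma(p)=q$. A path from $p$ to $q$ is a set $\{p_1,\dots,p_k\}$ of pairwise distinct cells with $p_1=p$, $p_k=q$, $\tau_j(p_{j+1})=p_j$ for some $\tau_j\in\Sigma$; $\Omega_{p,q}$ is the set of such paths. Feedforward: no cycles of length $\ge2$ (a cycle is a path $\{p_1,\dots,p_k\}$ with additionally $\tau(p_1)=p_k$ for some $\tau$). $p\trianglelefteq q$ iff there is a path from $q$ to $p$ (partial order); $q\vartriangleright p$ iff $p\trianglelefteq q$, $p\ne q$; maximal cells have $\sigma(p)=p$ for all $\sigma$. $\Sigma^\star(p)=\{\sigma(p):\sigma\in\Sigma\}\setminus\{p\}$.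 Subnetwork: nonempty $B$ with $\sigma(B)\subset B$ for all $\sigma$. Root subnetwork: subnetwork $B\subsetneq C$ containing all maximal cells such that each $p\notin B$ with all $q\vartriangleright p$ in $B$ is critical. Bifurcation setting: $V=\mathbb R$, smooth $f\colon\mathbb R^n\times\mathbb R\to\mathbb R$ with first $n$ arguments labelled by $\Sigma$, $\gamma_f(x,\lambda)_p=f(x_{\sigma_1(p)},\dots,x_{\sigma_n(p)},\lambda)$. Coefficients: $a_\sigma=\partial_\sigma f(0,0)$, $f_{\sigma\tau}=\tfrac12\partial_\sigma\partial_\tau f(0,0)$, $f_{\sigma\lambda}=\partial_\sigma\partial_\lambda f(0,0)$, $\ell=\partial_\lambda f(0,0)$, $f_{\lambda\lambda}=\tfrac12\partial_\lambda^2f(0,0)$. $\mathcal L_p=\{\sigma:\sigma(p)=p\}$; $p$ critical iff $\sum_{\sigma\in\mathcal L_p}a_\sigma=0$. (B): $f(0,0)=0$, some cell critical, exactly the cells sharing $\mathcal L_p$ with a critical cell are critical. $X(\lambda)=-\frac{\ell}{K}\lambda+O(\lambda^2)$ is the unique steady-state branch in the fully synchronous subspace. For $p\notin B$: $\mu_p=\max_{\bar p\in B}\max_{\omega\in\Omega_{\bar p,p}}\#\{q\in\omega: q\text{ critical},q\notin B\}-1$; $\mu_p=0$ for $p\in B$. $\mathbf Q_p=\{q\in\Sigma^\star(p):\mu_q=\max_{s\vartriangleright p}\mu_s\}$.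
   Formalization: The final claim that cells outside B are not synchronous with B is not asserted: it fails when μ_p=0 and D_p=-ℓ/K, and otherwise follows from the expansions; on B the common value is stated as synchronous with expansion D_pλ+O(λ²), which local uniqueness identifies with X(λ). *)

(* Defs.v *)
From HB Require Import structures.
From mathcomp Require Import all_boot all_order all_algebra.
From mathcomp Require Import all_classical all_reals all_analysis.
Set Implicit Arguments. Unset Strict Implicit. Unset Printing Implicit Defensive.
Import Order.TTheory GRing.Theory Num.Theory.
Import numFieldNormedType.Exports.

Section Network.
Variables (C : finType) (n : nat) (sig : 'I_n -> C -> C).

Definition arr (x y : C) : bool := [exists i, sig i y == x].

Definition is_path (p q : C) (s : seq C) : bool :=
  if s is x :: s' then [&& x == p, path arr x s', last x s' == q & uniq s]
  else false.

(* paths have at most #|C| cells, so this is "there is a path from p to q" *)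
Definition has_path (p q : C) : bool :=
  [exists k : 'I_#|C|.+1, exists t : k.-tuple C, is_path p q t].

Definition cle (p q : C) : bool := has_path q p.
Definition clt (p q : C) : bool := cle p q && (p != q).

Definition feedforward : Prop :=
  forall (p q : C) (s : seq C), is_path p q s -> (2 <= size s)%N -> ~~ arr q p.

Definition maximal (p : C) : Prop := forall q, cle p q -> q = p.

Definition Lp (p : C) : pred 'I_n := fun i => sig i p == p.

Definition subnetwork (B : {set C}) : Prop :=
  B != finset.set0 /\ forall i x, x \in B -> sig i x \in B.

Definition root_subnetwork (crit : pred C) (B : {set C}) : Prop :=
  [/\ subnetwork B, B \proper finset.setTfor C, (forall p, maximal p -> p \in B)
    & forall p, p \notin B -> (forall q, clt p q -> q \in B) -> crit p].

Definition ncrit (crit : pred C) (B : {set C}) (s : seq C) : nat :=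
  count (fun q => crit q && (q \notin B)) s.

Definition mu (crit : pred C) (B : {set C}) (p : C) : nat :=
  if p \in B then 0%N else
  ((\max_(k < #|C|.+1)
      \max_(t : k.-tuple C | [exists pb in B, is_path pb p t]) ncrit crit B t) - 1)%N.

Definition Qp (crit : pred C) (B : {set C}) (p : C) : pred C := fun q =>
  [&& q != p, [exists i, sig i p == q] &
      mu crit B q == (\max_(s | clt p s) mu crit B s)%N].

End Network.

Local Open Scope ring_scope.

Section Analysis.
Variable R : realType.

Definition ecoord (m : nat) (j : 'I_m) : 'rV[R]_m := delta_mx 0 j.

Fixpoint Ck (m : nat) (k : nat) (g : 'rV[R]_m -> R) {struct k} : Prop :=
  match k with
  | 0 => continuous g
  | k'.+1 => continuous g /\
      forall j : 'I_m, (forall x, derivable g x (ecoord j)) /\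
                       Ck k' (fun x => 'D_(ecoord j) g x)
  end.

Definition smooth (m : nat) (g : 'rV[R]_m -> R) : Prop := forall k, Ck k g.

Variables (C : finType) (n : nat) (sig : 'I_n -> C -> C) (f : 'rV[R]_(n + 1) -> R).

(* the first n arguments of f are labelled by Sigma, the last one is lambda *)
Definition eS (i : 'I_n) : 'rV[R]_(n + 1) := ecoord (lshift 1 i).
Definition eL : 'rV[R]_(n + 1) := ecoord (rshift n (@ord0 0)).

Definition acoef (i : 'I_n) : R := 'D_(eS i) f 0.
Definition fss (i j : 'I_n) : R := 'D_(eS i) ('D_(eS j) f) 0 / 2.
Definition fsl (i : 'I_n) : R := 'D_(eS i) ('D_eL f) 0.
Definition ell : R := 'D_eL f 0.
Definition Kc : R := \sum_i acoef i.

Definition critical (p : C) : bool := \sum_(i | Lp sig p i) acoef i == 0.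
Definition Acoef (p : C) : R := \sum_(i | Lp sig p i) \sum_(j | Lp sig p j) fss i j.

Definition fargs (x : C -> R) (lam : R) (p : C) : 'rV[R]_(n + 1) :=
  row_mx (\row_i x (sig i p)) (\row_(j < 1) lam).
Definition gamma (x : C -> R) (lam : R) (p : C) : R := f (fargs x lam p).

Definition assumptionB : Prop :=
  [/\ f 0 = 0, exists p, critical p &
      forall q, critical q <-> exists p, critical p /\ Lp sig p =i Lp sig q].

Definition Dcoeffs (B : {set C}) (D : C -> R) : Prop :=
  let muB := mu sig critical B in
  let QB := Qp sig critical B in
  let sL p := \sum_(i | Lp sig p i) acoef i in
  let sN p := \sum_(i | ~~ Lp sig p i) acoef i * D (sig i p) in
  let sQ p := \sum_(i | QB p (sig i p)) acoef i * D (sig i p) in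
  forall p, D p <> 0 /\
  (p \in B -> D p = - ell / Kc) /\
  (p \notin B -> ~~ critical p -> muB p = 0%N -> D p = - (sN p + ell) / sL p) /\
  (p \notin B -> ~~ critical p -> (0 < muB p)%N -> D p = - sQ p / sL p) /\
  (p \notin B -> critical p -> muB p = 0%N ->
     Acoef p <> 0 /\
     D p = ell / Kc * (1 + 2 * (\sum_(i | Lp sig p i) \sum_(j | ~~ Lp sig p j) fss i j)
                            / Acoef p)
           - (\sum_(i | Lp sig p i) fsl i) / Acoef p) /\
  (critical p -> muB p = 1%N ->
     (sN p + ell) / Acoef p < 0 /\
     (D p = Num.sqrt (- ((sN p + ell) / Acoef p)) \/
      D p = - Num.sqrt (- ((sN p + ell) / Acoef p)))) /\
  (critical p -> (1 < muB p)%N ->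
     sQ p / Acoef p < 0 /\
     (D p = Num.sqrt (- (sQ p / Acoef p)) \/ D p = - Num.sqrt (- (sQ p / Acoef p)))).

End Analysis.

(* Main.v *)
Require Import Defs.
From HB Require Import structures.
From mathcomp Require Import all_boot all_order all_algebra.
From mathcomp Require Import all_classical all_reals all_analysis.
From mathcomp Require Import ring lra zify.
Import Order.TTheory GRing.Theory Num.Theory.
Import numFieldNormedType.Exports.
Local Open Scope ring_scope.

(** The steady-state equation is solved cell by cell along the feedforward
    order, starting from the synchronous branch [X] on the root subnetwork [B].
    Once the inputs of a cell [p] are known, its equation is a scalar one,
    [G y = f (y on L_p, inputs elsewhere, lambda) = 0], and Taylor expansion gives
    [G y' - G y = (y' - y) (a + A (y + y') + b(lambda)) + O(t^2) (y' - y)] when all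
    arguments are [O(t)], where [a] and [A] are the sums of the [a_sigma] and of the
    [f_sigma_tau] over [L_p] and [t = lambda ^ (2 ^ -mu_p)].  At the predicted
    solution [D_p t] one has [G = O(t^(e+2))] with slope of exact order [t^e],
    where [e = 0] for a non-critical cell and [e = 1] for a critical one, so the
    intermediate value theorem produces a zero within [O(t^2)] of [D_p t], and
    monotonicity makes it continuous in [lambda].

    For a critical cell with [mu_p = 0] every input follows [X], so that [y = X]
    already solves the equation and [D_p lambda] approximates the second zero; if
    [D_p] happens to be the coefficient of [X], the cell simply follows [X].

    Writing [c p] for the maximal number of critical cells outside [B] on a path
    from [B] to [p], one has [mu = c - 1] everywhere, and the maximum of [mu] above
    [p] is [mu p] or [mu p - 1] according to whether [p] is critical: the inputs of
    [p] live on the scale [t] in the first case and [t ^ 2] in the second. *)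

(** * Paths, the upstream order and the count of critical cells *)

Section Combinatorics.
Local Open Scope nat_scope.
Variables (C : finType) (n : nat) (sig : 'I_n -> C -> C).
Implicit Types (p q : C) (s : seq C).

Lemma is_pathP p q s : reflect
  (exists2 s', s = p :: s' & [/\ path (arr sig) p s', last p s' = q & uniq (p :: s')])
  (is_path sig p q s).
Proof.
apply: (iffP idP) => [|[s' -> [ps' ls' us']]].
  case: s => // x s' /and4P[/eqP-> ps /eqP ls us]; by exists s'.
by rewrite /is_path eqxx ps' ls' eqxx us'.
Qed.

Lemma connect_is_path p q : connect (arr sig) p q -> exists s, is_path sig p q s.
Proof.
case/connectP => s ps ->; case/shortenP: ps => s' ps' us' _.
by exists (p :: s'); apply/is_pathP; exists s'.
Qed.

Lemma is_path_connect {p q s} : is_path sig p q s -> connect (arr sig) p q.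
Proof. by case/is_pathP=> s' _ [ps' ls' _]; apply/connectP; exists s'. Qed.

Lemma is_path_size {p q s} : is_path sig p q s -> size s < #|C|.+1.
Proof.
case/is_pathP=> s' -> [_ _ us']; rewrite ltnS -(card_uniqP us').
exact: max_card.
Qed.

Lemma has_pathE p q : has_path sig p q = connect (arr sig) p q.
Proof.
apply/idP/idP => [/existsP[k /existsP[t /is_path_connect//]]|].
case/connect_is_path=> s ps; apply/existsP; exists (Ordinal (is_path_size ps)).
by apply/existsP; exists (in_tuple s).
Qed.

Lemma is_path_rcons p q s : is_path sig p q s -> p != q ->
  exists r s', [/\ s = rcons s' q, is_path sig p r s', arr sig r q & r != q].
Proof.
case/is_pathP => s1 -> [+ + +] npq; case/lastP: s1 => [|s1 x] /=.
  by move=> _ /eqP; rewrite (negbTE npq).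
rewrite rcons_path last_rcons => /andP[ps1 ax] <-.
rewrite mem_rcons in_cons negb_or rcons_uniq -andbA => /and4P[npx ns1 nx us1].
exists (last p s1), (p :: s1); split => //.
  by apply/is_pathP; exists s1; rewrite //= ns1 us1.
have := mem_last p s1; rewrite in_cons => /predU1P[->//|ml].
by apply: contraNneq nx => <-.
Qed.

Hypothesis ff : feedforward sig.

(** If [p] and [q] were distinct, let [r] be the second cell of a path from [p] to [q]. Going on to
    [q] and back to [p] yields a path from [r] to [p] with at least two cells, which the arrow from
    [p] to [r] closes to a forbidden cycle. *)
Lemma connect_arr_anti p q :
  connect (arr sig) p q -> connect (arr sig) q p -> p = q.
Proof.
move=> pq qp; apply/eqP; apply: contraT => npq.
have [s] := connect_is_path _ _ pq.
case/is_pathP => -[|r s'] _ [/=]; first by move=> _ /eqP; rewrite (negbTE npq).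
case/andP => apr prs lq; rewrite in_cons negb_or => /andP[/andP[npr _] _].
have rp : connect (arr sig) r p.
  by apply: connect_trans qp; apply/connectP; exists s'.
have [t pt] := connect_is_path _ _ rp.
suff st : 2 <= size t by have := ff _ _ _ pt st; rewrite apr.
case/is_pathP: pt => -[|? ?] -> [] //= _ /eqP.
by rewrite eq_sym (negbTE npr).
Qed.

(** Strictly increasing along arrows between distinct cells, hence a measure for induction down the
    network. *)
Definition rank p := #|[pred q | connect (arr sig) q p]|.

Lemma rank_lt p q : connect (arr sig) q p -> q != p -> rank q < rank p.
Proof.
move=> qp nqp; apply/proper_card/properP; split.
  by apply/fintype.subsetP => r; rewrite !inE => /connect_trans; apply.
exists p; rewrite !inE ?connect0//; apply: contraNN nqp => pq.
by apply/eqP/connect_arr_anti.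
Qed.

Lemma arr_sig i p : arr sig (sig i p) p.
Proof. by apply/existsP; exists i. Qed.

(** A cell of minimal rank outside [S] works, since its proper inputs have smaller rank. With [S]
    empty this produces a maximal cell; with [S] the set of solved cells it produces the next one to
    solve. *)
Lemma exists_next (S : {set C}) : (exists p, p \notin S) ->
  exists2 p, p \notin S & forall i, sig i p != p -> sig i p \in S.
Proof.
case=> p0 np0; case: (@arg_minnP _ p0 (fun p => p \notin S) rank np0) => p np minp.
exists p => // i nip; apply: contraNT nip => nS.
apply: contraLR (minp _ nS) => nip; rewrite -ltnNge.
exact: rank_lt (connect1 (arr_sig _ _)) nip.
Qed.

Lemma fixed_maximal p : (forall i, sig i p = p) -> maximal sig p.
Proof.
move=> fp q; rewrite /cle has_pathE => /connect_is_path[s ps].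
apply/eqP; apply: contraT => nqp.
have [r [s' [_ _ /existsP[i]]]] := is_path_rcons _ _ _ ps nqp.
by rewrite fp => /eqP<-; rewrite eqxx.
Qed.

Section Mu.
Variables (crit : pred C) (B : {set C}).
Hypothesis rB : root_subnetwork sig crit B.

(** The count [c] of the opening comment: [mu] before the subtraction of 1, taken on [B] as well. *)
Definition max_ncrit p := \max_(k < #|C|.+1)
  \max_(t : k.-tuple C | [exists pb in B, is_path sig pb p t]) ncrit crit B t.

Lemma ncrit_le_max pb p s : pb \in B -> is_path sig pb p s ->
  ncrit crit B s <= max_ncrit p.
Proof.
move=> Bpb ps; rewrite /max_ncrit.
apply: (bigop.bigmax_sup (Ordinal (is_path_size ps))) => //.
apply: (bigop.bigmax_sup (in_tuple s)) => //.
by apply/existsP; exists pb; rewrite Bpb.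
Qed.

Lemma max_ncrit_le p m :
  (forall pb s, pb \in B -> is_path sig pb p s -> ncrit crit B s <= m) ->
  max_ncrit p <= m.
Proof.
move=> h; apply/bigmax_leqP => k _; apply/bigmax_leqP => t.
by case/existsP => pb /andP[Bpb]; apply: h.
Qed.

Lemma mem_connect_B p q : q \in B -> connect (arr sig) p q -> p \in B.
Proof.
case: rB => -[_ clB] _ _ _ + /connectP[s]; elim: s p => [|x s IH] p /=.
  by move=> qB _ <-.
move=> qB /andP[/existsP[i /eqP<-] ps] lq; exact/clB/(IH _ qB ps lq).
Qed.

Lemma is_path_mem {p q s x} : is_path sig p q s -> x \in s -> connect (arr sig) x q.
Proof.
case/is_pathP => s' -> [ps' <- _]; elim: s' p ps' => [|y s' IH] p /=.
  by move=> _; rewrite inE => /eqP->.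
case/andP => apy ps'; rewrite in_cons => /predU1P[->|]; last exact: IH.
by apply: connect_trans (connect1 apy) _; apply/connectP; exists s'.
Qed.

(** [B] contains everything upstream of its cells, so a path ending in [B] never leaves it. *)
Lemma max_ncrit_B p : p \in B -> max_ncrit p = 0.
Proof.
move=> Bp; apply/eqP; rewrite -leqn0; apply: max_ncrit_le => pb s _ ps.
rewrite leqn0 /ncrit -leqn0 leqNgt -has_count; apply/hasPn => x xs.
by rewrite (mem_connect_B _ _ Bp (is_path_mem ps xs)) andbF.
Qed.

(** On [B] this relies on truncated subtraction: 0 - 1 = 0. *)
Lemma muE p : mu sig crit B p = max_ncrit p - 1.
Proof. by rewrite /mu; case: ifP => [/max_ncrit_B->|]. Qed.

(** Prolong a path from [B] to [q] by one from [q] to [p]: no counted cell is lost, and [p] is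
    gained when it is critical. *)
Lemma max_ncrit_connect p q : p \notin B -> connect (arr sig) q p -> q != p ->
  max_ncrit q <= max_ncrit p - crit p.
Proof.
move=> nBp qp nqp; apply: max_ncrit_le => pb s Bpb /[dup] ps.
case/is_pathP => s1 Es [ps1 ls1 us1].
have [s'] := connect_is_path _ _ qp; case/is_pathP => s2 _ [ps2 ls2 us2].
(* No cell repeats: one lying on both pieces would be upstream and downstream of [q], hence [q]
   itself, which [s2] omits. *)
have pc : is_path sig pb p (s ++ s2).
  rewrite Es; apply/is_pathP; exists (s1 ++ s2); first by [].
  rewrite cat_path last_cat ls1 ps1 ls2; split=> //.
  move: us2; rewrite cons_uniq -cat_cons cat_uniq us1 => /andP[nq2 ->].
  rewrite andbT andTb.
  apply/hasPn => x x2; apply: contraNN nq2 => x1.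
  have xq : connect (arr sig) x q by apply: is_path_mem ps _; rewrite Es.
  suff qx : connect (arr sig) q x by rewrite (connect_arr_anti _ _ qx xq).
  by move: ps2; case/splitPr: x2 => s3 s4; rewrite cat_path /= => /and3P[p3 a _];
     apply: connect_trans (connect1 a); apply/connectP; exists s3.
have := ncrit_le_max _ _ _ Bpb pc; rewrite /ncrit count_cat.
suff : crit p <= count (fun q => crit q && (q \notin B)) s2 by lia.
case cp: (crit p) => //; rewrite -has_count; apply/hasP; exists p; last first.
  by rewrite cp nBp.
case: s2 ls2 {ps2 us2 pc} => [/= qp'|x s2 <-]; first by rewrite qp' eqxx in nqp.
by rewrite /= mem_last.
Qed.

(** A path from [B] to a cell [p] outside [B] passes through an input of [p] just before its end,
    and only the last cell [p] can add to the count. *)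
Lemma max_ncrit_inputs p m : p \notin B ->
  (forall q, arr sig q p -> q != p -> max_ncrit q <= m) ->
  max_ncrit p <= m + crit p.
Proof.
move=> nBp h; apply: max_ncrit_le => pb s Bpb ps.
have npb : pb != p by apply: contraNneq nBp => <-.
have [r [s' [-> ps' arp nrp]]] := is_path_rcons _ _ _ ps npb.
have := leq_trans (ncrit_le_max _ _ _ Bpb ps') (h _ arp nrp).
rewrite /ncrit -cats1 count_cat /= nBp andbT; lia.
Qed.

(** Induction on rank. If all cells above [p] are in [B], the root condition makes [p] critical, and
    [p], not being maximal, is reached from [B]. Otherwise a cell above [p] outside [B] already has
    positive count. Hence the subtraction in [mu] is never truncated outside [B]. *)
Lemma max_ncrit_gt0 p : p \notin B -> 0 < max_ncrit p.
Proof.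
elim: {p}(rank p) {-2}p (leqnn (rank p)) => [|r IH] p rp nBp.
  move: rp; rewrite leqn0 => /eqP/card0_eq/(_ p).
  by rewrite inE /= connect0.
case: rB => _ _ maxB critB.
have [/forallP allB|] := boolP [forall q, clt sig p q ==> (q \in B)].
  have cp : crit p by apply: critB => // q cq; apply: (implyP (allB q)).
  have [q [cq nq]] : exists q, cle sig p q /\ q != p.
    apply: contrapT => nq; move/negP: nBp; apply; apply: maxB => q cq.
    by apply/eqP; apply: contraT => nqp; case: nq; exists q.
  have Bq : q \in B by apply: (implyP (allB q)); rewrite /clt cq eq_sym.
  move: cq; rewrite /cle has_pathE => /connect_is_path[s ps].
  apply: leq_trans (ncrit_le_max _ _ _ Bq ps); rewrite /ncrit -has_count.
  apply/hasP; exists p; last by rewrite cp.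
  by case/is_pathP: ps => s' -> [_ <- _]; rewrite mem_last.
case/forallPn => q; rewrite negb_imply => /andP[/andP[cq nqp] nBq].
move: cq; rewrite /cle has_pathE => cq; rewrite eq_sym in nqp.
have rq : rank q <= r by rewrite -ltnS; apply: leq_trans rp; apply: rank_lt.
have := IH q rq nBq; have := max_ncrit_connect _ _ nBp cq nqp; lia.
Qed.

(** An input outside [B] has count at least 1, so the critical cell [p] would have count at least 2,
    that is, [mu] at least 1. *)
Lemma crit_mu0_inputs p i : p \notin B -> crit p -> mu sig crit B p = 0 ->
  sig i p != p -> sig i p \in B.
Proof.
move=> nBp cp; rewrite muE => mu0 nip; apply: contraT => /max_ncrit_gt0.
have := max_ncrit_connect _ _ nBp (connect1 (arr_sig i p)) nip.
rewrite cp; lia.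
Qed.

(** One inequality is monotonicity of the count, the other its bound through the inputs. The maximum
    in the definition of [Qp] thereby becomes an explicit index for the scale of the inputs. *)
Lemma max_mu p : p \notin B ->
  \max_(s | clt sig p s) mu sig crit B s = mu sig crit B p - crit p.
Proof.
move=> nBp; apply/eqP; rewrite eqn_leq; apply/andP; split.
  apply/bigmax_leqP => q; rewrite /clt /cle has_pathE eq_sym => /andP[cq nqp].
  by have := max_ncrit_connect _ _ nBp cq nqp; rewrite !muE; lia.
set m := \max_(s | _) _; rewrite muE.
(* [mu] at most [m] means count at most [m + 1], on [B] and off it. *)
suff : max_ncrit p <= m.+1 + crit p by lia.
apply: max_ncrit_inputs => // q aq nqp.
suff : mu sig crit B q <= m by rewrite muE; lia.
by apply: leq_bigmax_cond; rewrite /clt /cle has_pathE connect1// eq_sym.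
Qed.

Lemma mu_input p i : p \notin B -> sig i p != p ->
  mu sig crit B (sig i p) <= mu sig crit B p - crit p.
Proof.
move=> nBp nip; rewrite -max_mu//; apply: leq_bigmax_cond.
by rewrite /clt /cle has_pathE connect1 ?arr_sig// eq_sym.
Qed.

Lemma Qp_input p i : p \notin B ->
  Qp sig crit B p (sig i p) = (sig i p != p) &&
    (mu sig crit B (sig i p) == mu sig crit B p - crit p).
Proof.
move=> nBp; rewrite /Qp max_mu//; congr (_ && _).
by rewrite (_ : [exists _, _] = true)//; apply/existsP; exists i.
Qed.

End Mu.
End Combinatorics.

(** * Taylor estimates at 0 and symmetry of second derivatives, from coordinate-wise smoothness *)

Section MultivariateTaylor.
Variable R : realType.
Local Open Scope classical_set_scope.

Lemma is_deriveP (V : normedModType R) (g : V -> R) (x v : V) (d : R) :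
  is_derive x v g d <-> forall e : R, 0 < e -> exists2 dl : R, 0 < dl &
    forall h : R, h != 0 -> `|h| < dl -> `|d - h^-1 * (g (h *: v + x) - g x)| <= e.
Proof.
split=> [[dg <-] e e0|H].
  move/cvgrPdist_le/(_ e e0): dg; rewrite near_withinE => /nbhs_norm0P[dl /= dl0 H].
  by exists dl => // h h0 hdl; apply: H.
have cv : (fun h => h^-1 *: ((g \o shift x) (h *: v) - g x)) @ 0^' --> d.
  apply/cvgrPdist_le => e /H[dl dl0 Hdl]; rewrite near_withinE.
  by apply/(@nbhs_norm0P R R^o); exists dl => //= h hdl h0; exact: Hdl.
by split; [apply/cvg_ex; exists d | exact: (cvg_lim _ cv)].
Qed.

Lemma is_deriveZdir (V : normedModType R) (g : V -> R) (x v : V) (d c : R) :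
  is_derive x v g d -> is_derive x (c *: v) g (c * d).
Proof.
have [->|c0] := eqVneq c 0; first by rewrite scale0r mul0r => _; exact: is_derive0.
move/is_deriveP => H; apply/is_deriveP => e e0.
have nc : 0 < `|c| by rewrite normr_gt0.
have [dl dl0 Hdl] := H (e / `|c|) (divr_gt0 e0 nc).
exists (dl / `|c|) => [|h h0 hdl]; first exact: divr_gt0.
have := Hdl (h * c) (mulf_neq0 h0 c0).
rewrite normrM -ltr_pdivlMr// => /(_ hdl).
rewrite -scalerA ler_pdivlMr// mulrC -normrM mulrBr; set q := g _ - _.
by have -> : c * ((h * c)^-1 * q) = h^-1 * q by field; rewrite c0 h0.
Qed.

Lemma is_derive_line (V : normedModType R) (g : V -> R) (x v : V) (s d : R) :
  is_derive (s *: v + x) v g d -> is_derive s 1 (fun s => g (s *: v + x)) d.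
Proof.
move/is_deriveP => H; apply/is_deriveP => e /H[dl dl0 Hdl].
exists dl => // h h0 hdl; have := Hdl h h0 hdl.
by rewrite [h *: 1]mulr1 scalerDl addrA.
Qed.

Lemma MVT_dir (V : normedModType R) (g dg : V -> R) (x v : V) :
  (forall y, is_derive y v g (dg y)) ->
  exists2 th : R, 0 <= th <= 1 & g (v + x) - g x = dg (th *: v + x).
Proof.
move=> H; have D (s : R) : is_derive s 1 (fun s => g (s *: v + x)) (dg (s *: v + x)).
  exact: is_derive_line.
have [|th th01] := @MVT_segment _ (fun s => g (s *: v + x))
    (fun s => dg (s *: v + x)) 0 1 ler01.
- by apply: derivable_within_continuous => y _; exact: ex_derive.
- rewrite subr0 mulr1 scale1r scale0r add0r => E; exists th => //.
Qed.

(** Move first along [h *: u], then along [h *: v]. The mean value theorem writes the second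
    increment as [h] times [dg] at a point tending to [x], where [dg] is continuous. *)
Lemma is_deriveDdir (V : normedModType R) (g dg : V -> R) (x u v : V) (d : R) :
  (forall y, is_derive y v g (dg y)) -> {for x, continuous dg} ->
  is_derive x u g d -> is_derive x (u + v) g (d + dg x).
Proof.
move=> Dv cdg /is_deriveP Du; apply/is_deriveP => e e0.
have e20 : 0 < e / 2 by rewrite divr_gt0.
have [d1 d10 H1] := Du _ e20.
move/cvgrPdist_le/(_ _ e20)/nbhs_normP: cdg => [d2 /= d20 H2].
have N0 : 0 < `|u| + `|v| + 1 by rewrite ltr_wpDl// addr_ge0.
exists (Num.min d1 (d2 / (`|u| + `|v| + 1))) => [|h h0].
  by rewrite lt_min d10 divr_gt0.
rewrite lt_min ltr_pdivlMr// => /andP[hd1 hd2].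
have [th /andP[th0 th1] E] := @MVT_dir _ g (fun y => h * dg y) (h *: u + x) (h *: v)
  (fun y => is_deriveZdir _ _ _ _ _ h (Dv y)).
have -> : g (h *: (u + v) + x) =
    h * dg (th *: (h *: v) + (h *: u + x)) + g (h *: u + x).
  by rewrite -E scalerDr (addrC (h *: u)) -addrA subrK.
set w := dg (_ + _); set g1 := g (h *: u + x).
have -> : d + dg x - h^-1 * (h * w + g1 - g x) =
    (dg x - w) + (d - h^-1 * (g1 - g x)).
  by field.
rewrite (le_trans (ler_normD _ _))// [leRHS](splitr e) lerD//; last exact: H1.
apply: H2; rewrite /ball_/= addrA opprD [_ - x]addrC addrA subrr add0r normrN.
apply: le_lt_trans (hd2); rewrite (le_trans (ler_normD _ _))// !normrZ (ger0_norm th0).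
rewrite mulrDr mulr1 ler_wpDr// mulrDr [leRHS]addrC lerD//.
by rewrite ler_piMl// mulr_ge0.
Qed.

Lemma coord_le_norm m (v : 'rV[R]_m) j : `|v 0 j| <= `|v|.
Proof.
rewrite [leRHS]/Num.Def.normr/= mx_normrE.
by apply/bigmax_geP; right; exists (0, j).
Qed.

Lemma norm_le_coord m (v : 'rV[R]_m) r : 0 <= r ->
  (forall j, `|v 0 j| <= r) -> `|v| <= r.
Proof.
move=> r0 H; rewrite /Num.Def.normr/= mx_normrE bigmax_le// => -[i j] _ /=.
by rewrite ord1.
Qed.

Lemma rV_sum_ecoord m (v : 'rV[R]_m) : v = \sum_j v 0 j *: ecoord R j.
Proof. exact: row_sum_delta. Qed.

(** [Ck] only speaks of coordinate directions; adding them one at a time with [is_deriveDdir]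
    reaches every vector. *)
Lemma Ck_is_derive m (g : 'rV[R]_m -> R) (x v : 'rV[R]_m) :
  Ck 1 g -> is_derive x v g (\sum_j v 0 j * 'D_(ecoord R j) g x).
Proof.
move=> [_ H]; rewrite {1}(rV_sum_ecoord _ v).
elim/big_rec2: _ => [|j d w _ IH]; first exact: is_derive0.
rewrite addrC [_ + d]addrC.
apply: (is_deriveDdir _ g (fun y => v 0 j * 'D_(ecoord R j) g y)) IH.
  by move=> y; apply: is_deriveZdir; apply: derivableP; have [+ _] := H j; apply.
by have [_ cj] := H j; exact: cvgM (cvg_cst _) (cj x).
Qed.

Lemma CkW m k (g : 'rV[R]_m -> R) : Ck k.+1 g -> Ck k g.
Proof.
elim: k g => [|k IH] g /=; first by case.
move=> [cg H]; split => // j; have [Dj Cj] := H j; split=> //.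
exact: IH.
Qed.

Lemma near0_norm_le (V : normedModType R) (P : V -> Prop) :
  (\forall v \near (0 : V), P v) -> exists2 dl : R, 0 < dl &
    forall v, `|v| <= dl -> P v.
Proof.
move/nbhs_norm0P => [dl /= dl0 H]; exists (dl / 2); first by rewrite divr_gt0.
move=> v hv; apply: H; apply: le_lt_trans hv _.
by rewrite ltr_pdivrMr// ltr_pMr// ltr1n.
Qed.

Lemma near0_forall (V : normedModType R) (I : finType) (P : I -> V -> Prop) :
  (forall i, \forall v \near (0 : V), P i v) ->
  \forall v \near (0 : V), forall i, P i v.
Proof. exact: (@filter_forall _ _ P (nbhs (0 : V)) (nbhs_filter _)). Qed.

(** Mean value theorem on the segment from 0 to [v], where by continuity each partial derivative
    exceeds its size at 0 by at most 1. *)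
Lemma Ck1_lipschitz0 m (g : 'rV[R]_m -> R) : Ck 1 g ->
  exists2 K : R, 0 <= K & \forall v \near (0 : 'rV[R]_m), `|g v - g 0| <= K * `|v|.
Proof.
move=> Cg; pose K := \sum_j (`|'D_(ecoord R j) g 0| + 1).
exists K; first by rewrite sumr_ge0// => j _; rewrite addr_ge0.
have /near0_norm_le[dl dl0 H] : \forall v \near (0 : 'rV[R]_m), forall j,
    `|'D_(ecoord R j) g v| <= `|'D_(ecoord R j) g 0| + 1.
  apply: near0_forall => j.
  case: Cg => _ /(_ j)[_ /= cj].
  have /cvgrPdist_le/(_ 1 ltr01) := cj 0; apply: filterS => v hv.
  rewrite -lerBlDl (le_trans _ hv)// distrC (le_trans _ (lerB_dist _ _))//.
apply/nbhs_norm0P; exists dl => //= v /ltW hv.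
have [th /andP[th0 th1]] := @MVT_dir _ g _ 0 v (fun y => Ck_is_derive _ _ y v Cg).
rewrite !addr0 => ->; rewrite (le_trans (ler_norm_sum _ _ _))// mulr_suml.
apply: ler_sum => j _; rewrite normrM mulrC ler_pM ?coord_le_norm// H//.
by rewrite normrZ ger0_norm// (le_trans _ hv)// ler_piMl.
Qed.

(** The same segment argument, with each partial derivative now compared to its value at 0 by the
    Lipschitz bound. *)
Lemma Ck2_taylor0 m (g : 'rV[R]_m -> R) : Ck 2 g ->
  exists2 K : R, 0 <= K & \forall v \near (0 : 'rV[R]_m),
    `|g v - g 0 - \sum_j v 0 j * 'D_(ecoord R j) g 0| <= K * `|v| ^+ 2.
Proof.
move=> Cg; have Cg1 := CkW _ _ _ Cg.
have HK j : exists K : R, 0 <= K /\ \forall v \near (0 : 'rV[R]_m),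
    `|'D_(ecoord R j) g v - 'D_(ecoord R j) g 0| <= K * `|v|.
  have [_ /(_ j)[_ /Ck1_lipschitz0[K K0 H]]] := Cg; by exists K.
have [K hK] := choice HK.
have /near0_norm_le[dl dl0 H] : \forall v \near (0 : 'rV[R]_m), forall j,
    `|'D_(ecoord R j) g v - 'D_(ecoord R j) g 0| <= K j * `|v|.
  apply: near0_forall => j.
  by case: (hK j).
exists (\sum_j K j); first by rewrite sumr_ge0// => j _; case: (hK j).
apply/nbhs_norm0P; exists dl => //= v /ltW hv.
have [th /andP[th0 th1]] := @MVT_dir _ g _ 0 v (fun y => Ck_is_derive _ _ y v Cg1).
rewrite !addr0 => ->; rewrite -sumrB (le_trans (ler_norm_sum _ _ _))// mulr_suml.
apply: ler_sum => j _; rewrite -mulrBr normrM expr2 mulrA [leRHS]mulrC.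
have tv : `|th *: v| <= `|v| by rewrite normrZ ger0_norm// ler_piMl.
rewrite ler_pM ?coord_le_norm//; apply: le_trans (H _ _ _) _.
  exact: le_trans tv hv.
by rewrite ler_wpM2l//; case: (hK j).
Qed.

Lemma derive_bound (phi dphi : R -> R) (r M : R) :
  (forall s : R, is_derive s 1 phi (dphi s)) ->
  (forall s : R, `|s| <= r -> `|dphi s| <= M) ->
  forall a b, `|a| <= r -> `|b| <= r -> `|phi b - phi a| <= M * `|b - a|.
Proof.
move=> D H a b; wlog ab : a b / a <= b => [W ha hb|ha hb].
  have [/W|/ltW/W] := leP a b; first exact.
  by move=> /(_ hb ha); rewrite distrC (distrC a b).
have [|c + ->] := @MVT_segment _ phi dphi a b ab.
- by apply: derivable_within_continuous => y _; exact: ex_derive.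
rewrite in_itv /= => /andP[ac cb]; rewrite normrM ler_wpM2r// H//.
rewrite ler_norml in ha; rewrite ler_norml in hb; rewrite ler_norml; lra.
Qed.

Lemma sum_ecoord m (j : 'I_m) (c : 'I_m -> R) :
  \sum_k (ecoord R j) 0 k * c k = c j.
Proof.
rewrite (bigD1 j)//= big1 ?addr0 => [|k kj].
  by rewrite mxE !eqxx mul1r.
by rewrite mxE (negbTE kj) andbF mul0r.
Qed.

Lemma norm_ecoord m (j : 'I_m) : `|ecoord R j| <= 1.
Proof.
by apply: norm_le_coord => // k; rewrite mxE; case: (_ && _); rewrite ?normr1 ?normr0.
Qed.

(** The second difference is an increment over [[0, h]] of a function of one variable whose
    derivative is a difference of two values of ['D_(ecoord R i) g]; first-order Taylor at 0 applies
    to each of them. *)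
Lemma second_difference m (g : 'rV[R]_m -> R) (i j : 'I_m) : Ck 3 g ->
  exists2 K : R, 0 <= K & exists2 dl : R, 0 < dl & forall h : R, 0 <= h <= dl ->
    `|g (h *: ecoord R i + h *: ecoord R j) - g (h *: ecoord R i)
      - (g (h *: ecoord R j) - g 0)
      - h ^+ 2 * 'D_(ecoord R j) ('D_(ecoord R i) g) 0| <= K * h ^+ 3.
Proof.
move=> Cg; have [_ /(_ i)[Di /Ck2_taylor0[K K0 /near0_norm_le[dl dl0 H]]]] := Cg.
(* 5 = 4 + 1: the two base points have norm at most [2 * h] and [h], and the Taylor error is
   quadratic. *)
exists (5 * K); first exact: mulr_ge0.
exists (dl / 2) => [|h /andP[h0 hdl]]; first by rewrite divr_gt0.
set ei := ecoord R i; set ej := ecoord R j; set p := 'D_ej ('D_ei g) 0.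
(* [phi h - phi 0] is the quantity to bound. The summand [+ 0] gives both arguments the shape
   expected by [is_derive_line]. *)
pose phi s := g (s *: ei + h *: ej) - g (s *: ei + 0) - s * h * p.
pose dphi s := 'D_ei g (s *: ei + h *: ej) - 'D_ei g (s *: ei + 0) - h * p.
have Dphi (s : R) : is_derive s 1 phi (dphi s).
  apply: is_deriveB.
    by apply: is_deriveB; apply: is_derive_line; exact: derivableP.
  apply/is_deriveP => e e0; exists 1 => // t t0 _.
  rewrite [t *: 1]mulr1 (_ : _ - _ = 0) ?normr0 ?ltW//.
  by field.
have ds s : `|s| <= h -> `|dphi s| <= 5 * K * h ^+ 2.
  move=> hs; have n1 : `|s *: ei| <= h.
    rewrite normrZ (le_trans _ hs)// ler_piMr//; exact: norm_ecoord.
  have n2 : `|s *: ei + h *: ej| <= 2 * h.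
    rewrite (le_trans (ler_normD _ _))// mulrDl mul1r lerD// normrZ ger0_norm//.
    rewrite ler_piMr//; exact: norm_ecoord.
  have hd : 2 * h <= dl by rewrite mulrC -ler_pdivlMr.
  have /H T1 := le_trans n2 hd.
  have hd' : h <= dl by lra.
  have /H T2 := le_trans n1 hd'.
  have b1 : K * `|s *: ei + h *: ej| ^+ 2 <= K * (2 * h) ^+ 2.
    by rewrite ler_wpM2l// lerXn2r// nnegrE// mulr_ge0.
  have b2 : K * `|s *: ei| ^+ 2 <= K * h ^+ 2.
    by rewrite ler_wpM2l// lerXn2r// nnegrE.
  have S : \sum_k (s *: ei + h *: ej) 0 k * 'D_(ecoord R k) ('D_ei g) 0 =
      \sum_k (s *: ei) 0 k * 'D_(ecoord R k) ('D_ei g) 0 + h * p.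
    rewrite /p -(sum_ecoord _ j (fun k => 'D_(ecoord R k) ('D_ei g) 0)) mulr_sumr.
    rewrite -big_split /=; apply: eq_bigr => k _.
    by rewrite mxE mulrDl; congr (_ + _); rewrite mxE mulrA.
  rewrite {}S in T1; rewrite /dphi addr0.
  move: T1 T2 b1 b2; rewrite exprMn -/ei.
  set d0 := 'D_ei g 0; set d1 := 'D_ei g (_ + _); set d2 := 'D_ei g (s *: ei).
  set q := \sum_k _; move: (`|_| ^+ 2) (`|_| ^+ 2) => n3 n4.
  rewrite !ler_norml => /andP[? ?] /andP[? ?] ? ?; apply/andP; split; nra.
have := derive_bound _ _ _ _ Dphi ds 0 h.
rewrite normr0 ger0_norm// => /(_ h0 (lexx _)).
have -> : phi h - phi 0 = g (h *: ei + h *: ej) - g (h *: ei)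
    - (g (h *: ej) - g 0) - h ^+ 2 * p by rewrite /phi !scale0r addr0 !add0r; ring.
by rewrite subr0 (ger0_norm h0) [h ^+ 3]exprSr mulrA.
Qed.

(** The second difference is symmetric in [i] and [j], and divided by [h ^+ 2] it is within O(h) of
    either mixed derivative. *)
Lemma Ck3_schwarz m (g : 'rV[R]_m -> R) (i j : 'I_m) : Ck 3 g ->
  'D_(ecoord R j) ('D_(ecoord R i) g) 0 = 'D_(ecoord R i) ('D_(ecoord R j) g) 0.
Proof.
move=> Cg; have [K1 K10 [d1 d10 H1]] := second_difference _ _ i j Cg.
have [K2 K20 [d2 d20 H2]] := second_difference _ _ j i Cg.
set p := LHS; set q := RHS; apply/eqP; rewrite -subr_eq0 -normr_eq0.
apply/contraT => pq; have pq0 : 0 < `|p - q| by rewrite lt_def pq normr_ge0.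
set e := `|p - q| in pq pq0 *; have K0 : 0 < K1 + K2 + 1 by lra.
(* This [h] satisfies [h * (K1 + K2 + 1) <= e], while the two estimates give [e <= (K1 + K2) * h];
   together they force [h <= 0]. *)
pose h := Num.min (e / (K1 + K2 + 1)) (Num.min d1 d2).
have h0 : 0 < h by rewrite !lt_min d10 d20 divr_gt0.
have hd1 : h <= d1 by rewrite !ge_min lexx orbT.
have hd2 : h <= d2 by rewrite !ge_min lexx !orbT.
have he : h * (K1 + K2 + 1) <= e by rewrite -ler_pdivlMr// ge_min lexx.
have := H1 h; rewrite (ltW h0) hd1 => /(_ erefl) {}H1.
have := H2 h; rewrite (ltW h0) hd2 => /(_ erefl) {}H2.
rewrite [X in g X]addrC in H2.
move: H1 H2; rewrite -/p -/q.
set a := g (_ + _); set b := g (h *: ecoord R i); set c := g (h *: ecoord R j).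
set d := g 0; move: a b c d => a b c d H1 H2.
have {H1 H2} : `|h ^+ 2 * p - h ^+ 2 * q| <= K2 * h ^+ 3 + K1 * h ^+ 3.
  rewrite (_ : _ - _ = (a - c - (b - d) - h ^+ 2 * q) -
    (a - b - (c - d) - h ^+ 2 * p)); last by ring.
  by rewrite (le_trans (ler_normB _ _))// lerD.
have h2 : 0 < h ^+ 2 by rewrite exprn_gt0.
rewrite -mulrBr normrM (gtr0_norm h2) -/e.
rewrite (_ : _ + _ = h ^+ 2 * ((K1 + K2) * h)); last by ring.
rewrite ler_pM2l// => H3.
suff : h <= 0 by rewrite leNgt h0.
have := le_trans he H3; rewrite mulrC mulrDl mul1r gerDl.
exact.
Qed.

End MultivariateTaylor.

(** * Expansion of the equation of a single cell *)

Section CellEquation.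
Variables (R : realType) (n : nat) (f : 'rV[R]_(n + 1) -> R) (L : pred 'I_n).
Implicit Types (y l rho : R) (z : 'I_n -> R).

(** [y] is the unknown state, fed back through the self-inputs [L]. Entries of [z] on [L] are
    ignored, so [z] can be the family of all current input values. *)
Definition cell_args y z l : 'rV[R]_(n + 1) :=
  row_mx (\row_i (if L i then y else z i)) (\row_(j < 1) l).

Definition aL : R := \sum_(i | L i) acoef f i.
Definition AL : R := \sum_(i | L i) \sum_(j | L j) fss f i j.
(** The term [b(lambda)] of the opening comment: what the other inputs and the parameter contribute
    to the slope in [y]. The factor 2 undoes the one half in [fss]. *)
Definition mixedL z l : R :=
  \sum_(j | ~~ L j) z j * (2 * \sum_(i | L i) fss f i j) + l * \sum_(i | L i) fsl f i.

Lemma cell_args_sum y z l (c : 'I_(n + 1) -> R) :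
  \sum_j cell_args y z l 0 j * c j = y * \sum_(i | L i) c (lshift 1 i) +
    \sum_(i | ~~ L i) z i * c (lshift 1 i) + l * c (rshift n ord0).
Proof.
rewrite big_split_ord big_ord1 /= row_mxEr mxE; congr (_ + _).
rewrite (bigID L) /= mulr_sumr; congr (_ + _); apply: eq_bigr => i Li.
  by rewrite row_mxEl mxE Li.
by rewrite row_mxEl mxE (negbTE Li).
Qed.

Lemma cell_args_norm y z l rho : `|y| <= rho -> `|l| <= rho ->
  (forall i, ~~ L i -> `|z i| <= rho) -> `|cell_args y z l| <= rho.
Proof.
move=> hy hl hz; apply: norm_le_coord; first exact: le_trans hl.
move=> j; rewrite mxE; case: fintype.split => k; rewrite mxE//.
by case: ifPn => [//|/hz].
Qed.

Lemma cell_args_line y z l :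
  cell_args y z l = y *: cell_args 1 (fun=> 0) 0 + cell_args 0 z l.
Proof.
apply/rowP => j; rewrite !mxE; case: fintype.split => k; rewrite !mxE.
  by case: ifP => _; rewrite ?mulr1 ?mulr0 ?addr0 ?add0r.
by rewrite mulr0 add0r.
Qed.

Lemma is_derive_quadratic (c A s : R) :
  is_derive s 1 (fun s => s * c + A * s ^+ 2) (c + 2 * A * s).
Proof.
apply/is_deriveP => e e0; have A0 : 0 < `|A| + 1 by rewrite ltr_wpDl.
exists (e / (`|A| + 1)) => [|h h0]; first exact: divr_gt0.
rewrite ltr_pdivlMr// => /ltW he.
have -> : c + 2 * A * s - h^-1 * ((h *: 1 + s) * c + A * (h *: 1 + s) ^+ 2
    - (s * c + A * s ^+ 2)) = - (h * A).
  by rewrite [h *: 1]mulr1; field.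
by rewrite normrN normrM (le_trans _ he)// ler_wpM2l// lerDl.
Qed.

Hypothesis Cf : Ck 3 f.

(** The error must carry the factor [y' - y], which expanding [f] itself would not give. Therefore
    the partial derivatives along [L] are expanded to first order and the mean value inequality is
    applied in [y]. *)
Lemma cell_slope : exists2 K : R, 0 <= K & exists2 dl : R, 0 < dl &
  forall rho y y' z l, rho <= dl -> `|y| <= rho -> `|y'| <= rho ->
    `|l| <= rho -> (forall i, ~~ L i -> `|z i| <= rho) ->
    `|f (cell_args y' z l) - f (cell_args y z l) -
      (y' - y) * (aL + AL * (y + y') + mixedL z l)| <= K * rho ^+ 2 * `|y' - y|.
Proof.
have C1 := CkW _ _ _ _ (CkW _ _ _ _ Cf).
have HK (i : 'I_n) : exists K : R, 0 <= K /\
    \forall v \near (0 : 'rV[R]_(n + 1)), `|'D_(eS R i) f v - 'D_(eS R i) f 0 -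
      \sum_j v 0 j * 'D_(ecoord R j) ('D_(eS R i) f) 0| <= K * `|v| ^+ 2.
  have [_ /(_ (lshift 1 i))[_ /Ck2_taylor0[K K0 H]]] := Cf; by exists K.
have [K hK] := choice HK.
have /near0_norm_le[dl dl0 H] : \forall v \near (0 : 'rV[R]_(n + 1)), forall i,
    `|'D_(eS R i) f v - 'D_(eS R i) f 0 -
      \sum_j v 0 j * 'D_(ecoord R j) ('D_(eS R i) f) 0| <= K i * `|v| ^+ 2.
  by apply: near0_forall => i; case: (hK i).
exists (\sum_(i | L i) K i); first by rewrite sumr_ge0// => i _; case: (hK i).
exists dl => // rho y y' z l rd hy hy' hl hz.
pose u := cell_args 1 (fun=> 0) 0; pose v0 := cell_args 0 z l.
pose c := aL + mixedL z l.
pose phi s := f (s *: u + v0) - (s * c + AL * s ^+ 2).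
pose dphi s := \sum_j u 0 j * 'D_(ecoord R j) f (s *: u + v0) - (c + 2 * AL * s).
have Dphi (s : R) : is_derive s 1 phi (dphi s).
  apply: is_deriveB; last exact: is_derive_quadratic.
  by apply: is_derive_line; apply: Ck_is_derive.
(* In [fss i j] the inner derivative is along [j], in the expansion along [i]. For pairs in [L]
   exchanging the sums suffices; the terms off [L] and in the parameter use symmetry of second
   derivatives. *)
have mixE s : \sum_(i | L i) \sum_j cell_args s z l 0 j *
    'D_(ecoord R j) ('D_(eS R i) f) 0 = 2 * AL * s + mixedL z l.
  under eq_bigr do rewrite cell_args_sum.
  rewrite !big_split /= -addrA; congr (_ + _).
    rewrite -mulr_sumr mulrC /AL; congr (_ * _); rewrite exchange_big /= mulr_sumr.
    apply: eq_bigr => i _; rewrite mulr_sumr; apply: eq_bigr => j _.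
    by rewrite /fss /eS mulrC divfK ?pnatr_eq0.
  rewrite /mixedL; congr (_ + _).
    rewrite exchange_big /=; apply: eq_bigr => j _.
    rewrite -mulr_sumr; congr (_ * _); rewrite mulr_sumr; apply: eq_bigr => i _.
    apply: etrans (Ck3_schwarz _ _ f (lshift 1 i) (lshift 1 j) Cf) _.
    by rewrite [RHS]mulrC [RHS]divfK// pnatr_eq0.
  rewrite [RHS]mulr_sumr; apply: eq_bigr => i _; apply: f_equal.
  exact: (Ck3_schwarz _ _ f (lshift 1 i) (rshift n ord0) Cf).
have ds (s : R) : `|s| <= rho -> `|dphi s| <= \sum_(i | L i) K i * rho ^+ 2.
  move=> hs; rewrite /dphi cell_args_sum mul1r mul0r addr0 /v0 -cell_args_line.
  rewrite [X in _ + X - _]big1 => [|i _]; last by rewrite mul0r.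
  rewrite (_ : _ - _ = \sum_(i | L i) ('D_(eS R i) f (cell_args s z l)
    - 'D_(eS R i) f 0 -
      \sum_j cell_args s z l 0 j * 'D_(ecoord R j) ('D_(eS R i) f) 0)); last first.
    by rewrite !sumrB mixE /c /aL /acoef /eS; ring.
  rewrite (le_trans (ler_norm_sum _ _ _))// ler_sum// => i _.
  have nv := cell_args_norm _ _ _ _ hs hl hz.
  rewrite (le_trans (H _ _ _)) ?(le_trans nv)// ler_wpM2l//; first by case: (hK i).
  by rewrite lerXn2r// nnegrE// (le_trans _ hl).
have := derive_bound _ _ _ _ _ Dphi ds y y' hy hy'; rewrite -mulr_suml.
rewrite (_ : phi y' - phi y = f (cell_args y' z l) - f (cell_args y z l) -
      (y' - y) * (aL + AL * (y + y') + mixedL z l))//.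
by rewrite /phi /v0 /u -!cell_args_line /c; ring.
Qed.

Lemma cell_linear : f 0 = 0 -> exists2 K : R, 0 <= K & exists2 dl : R, 0 < dl &
  forall rho y z l, rho <= dl -> `|y| <= rho -> `|l| <= rho ->
    (forall i, ~~ L i -> `|z i| <= rho) ->
    `|f (cell_args y z l) - (y * aL + \sum_(i | ~~ L i) z i * acoef f i + l * ell f)|
      <= K * rho ^+ 2.
Proof.
move=> f0; have [K K0 /near0_norm_le[dl dl0 H]] := Ck2_taylor0 _ _ _ (CkW _ _ _ _ Cf).
exists K => //; exists dl => // rho y z l rd hy hl hz.
have nv := cell_args_norm _ _ _ _ hy hl hz.
have := H _ (le_trans nv rd); rewrite f0 subr0 cell_args_sum => /le_trans; apply.
by rewrite ler_wpM2l// lerXn2r// nnegrE// (le_trans _ hl).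
Qed.

End CellEquation.

Arguments cell_args {R n}.
Arguments aL {R n}.
Arguments AL {R n}.
Arguments mixedL {R n}.

(** * Zeros near approximate solutions, continuous in the parameter *)

Section Branch.
Variable R : realType.
Local Open Scope classical_set_scope.

Lemma near0rP (P : R -> Prop) : (\forall l \near (0 : R)^'+, P l) <->
  exists2 l0 : R, 0 < l0 & forall l : R, 0 < l < l0 -> P l.
Proof.
split=> [|[l0 l00 H]].
  rewrite near_withinE => /nbhs_normP[l0 /= l00 H]; exists l0 => // l /andP[l0l ll0].
  by apply: H => //=; rewrite sub0r normrN gtr0_norm.
rewrite near_withinE; apply/nbhs_normP; exists l0 => //= l.
by rewrite /ball_ /= sub0r normrN => hl l0l; apply: H; rewrite l0l -(gtr0_norm l0l).
Qed.

(** After division by [k] the slope is within 1/2 of 1 and the value at [y0] is at most [r / 4] in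
    size, so the signs at [y0 - r] and [y0 + r] differ. The slope bound then puts the zero within
    [2 * (r / 4)] of [y0]; the spare half of the radius serves continuity in the parameter. *)
Lemma newton_zero (G : R -> R) (y0 r k : R) : 0 < r -> k != 0 -> continuous G ->
  (forall y y' : R, `|y - y0| <= r -> `|y' - y0| <= r ->
    `|G y' - G y - k * (y' - y)| <= `|k| / 2 * `|y' - y|) ->
  `|G y0| <= `|k| * r / 4 ->
  exists2 x : R, G x = 0 & `|x - y0| <= r / 2.
Proof.
move=> r0 k0 cG dG G0; have nk : 0 < `|k| by rewrite normr_gt0.
pose H y := G y / k.
have dH y y' : `|y - y0| <= r -> `|y' - y0| <= r ->
    `|H y' - H y - (y' - y)| <= `|y' - y| / 2.
  move=> hy hy'; have -> : H y' - H y - (y' - y) = (G y' - G y - k * (y' - y)) / k.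
    by rewrite /H; field.
  by rewrite normrM normfV ler_pdivrMr// (le_trans (dG _ _ hy hy'))//; lra.
have H0 : `|H y0| <= r / 4 by rewrite normrM normfV ler_pdivrMr//; lra.
have hy0 : `|y0 - y0| <= r by rewrite subrr normr0 ltW.
have ha : `|y0 - r - y0| <= r by rewrite addrAC subrr add0r normrN gtr0_norm.
have hb : `|y0 + r - y0| <= r by rewrite addrAC subrr add0r gtr0_norm.
have Ha : H (y0 - r) <= 0.
  have := dH _ _ hy0 ha; move: H0.
  by rewrite [y0 - r - y0]addrAC subrr add0r normrN (gtr0_norm r0) !ler_norml; lra.
have Hb : 0 <= H (y0 + r).
  have := dH _ _ hy0 hb; move: H0.
  by rewrite [y0 + r - y0]addrAC subrr add0r (gtr0_norm r0) !ler_norml; lra.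
have [|||x] := @IVT _ H (y0 - r) (y0 + r) 0.
- lra.
- apply: continuous_subspaceT => y; apply: cvgM; [exact: cG | exact: cvg_cst].
- by rewrite ge_min Ha le_max Hb orbT.
rewrite in_itv /= => /andP[xa xb] Hx; exists x.
  by move/eqP: Hx; rewrite mulf_eq0 invr_eq0 (negbTE k0) orbF => /eqP.
have hx : `|x - y0| <= r by rewrite ler_norml; lra.
have := dH _ _ hy0 hx; rewrite Hx.
have : `|x - y0| <= `|0 - H y0 - (x - y0)| + `|H y0|.
  have E : 0 - H y0 - (x - y0) + H y0 = - (x - y0) by ring.
  by have := ler_normD (0 - H y0 - (x - y0)) (H y0); rewrite E normrN.
by lra.
Qed.

Lemma near_gt0 (F : R -> R) (l1 : R) : {for l1, continuous F} -> 0 < F l1 ->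
  \forall l \near l1, 0 < F l.
Proof.
by move=> cF F0; exact: (@cvgr_gt R R (nbhs l1) (nbhs_filter l1) F (F l1) cF 0 F0).
Qed.

Lemma continuous_dist (F : R -> R) (l1 : R) :
  (forall e : R, 0 < e -> \forall l \near l1, `|F l1 - F l| <= e) ->
  {for l1, continuous F}.
Proof.
by move=> H; apply/(@cvgrPdist_le R R R (nbhs l1) (nbhs_filter l1)) => e /H.
Qed.

(** Zeros are chosen parameter by parameter. For [l] near [l1], the number [x l1] still lies in the
    ball around [y0 l] and nearly solves the equation at [l]; the slope, at least [|k l| / 2] in
    size, then keeps [x l] close to it. *)
Lemma newton_branch (l0 : R) (G : R -> R -> R) (y0 r k : R -> R) :
  (forall l : R, 0 < l < l0 -> [/\ 0 < r l, k l != 0, {for l, continuous y0},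
    {for l, continuous r} & {for l, continuous k}]) ->
  (forall l : R, 0 < l < l0 -> continuous (G l)) ->
  (forall l y : R, 0 < l < l0 -> {for l, continuous (G ^~ y)}) ->
  (forall l y y' : R, 0 < l < l0 -> `|y - y0 l| <= r l -> `|y' - y0 l| <= r l ->
    `|G l y' - G l y - k l * (y' - y)| <= `|k l| / 2 * `|y' - y|) ->
  (forall l : R, 0 < l < l0 -> `|G l (y0 l)| <= `|k l| * r l / 4) ->
  exists x : R -> R, forall l : R, 0 < l < l0 ->
    [/\ G l (x l) = 0, `|x l - y0 l| <= r l & {for l, continuous x}].
Proof.
move=> Hrk cGy cGl dG G0.
have Hx (l : R) : exists x : R, 0 < l < l0 -> G l x = 0 /\ `|x - y0 l| <= r l / 2.
  (* Outside the interval 0 is a dummy value that makes the choice total. *)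
  have [hl|] := boolP (0 < l < l0); last by exists 0.
  have [r0 k0 _ _ _] := Hrk l hl.
  have [x xG xy] := newton_zero _ _ _ _ r0 k0 (cGy l hl)
    (fun y y' => dG l y y' hl) (G0 l hl).
  by exists x.
have [x {}Hx] := choice Hx; exists x => l1 hl1.
have [Gx1 xy1] := Hx _ hl1; have [r1 k1 cy0 cr ck] := Hrk _ hl1.
split => //; first by rewrite (le_trans xy1)// ler_pdivrMr// ler_peMr ?ltW// ltr1n.
apply: continuous_dist => e e0; have k10 : 0 < `|k l1| by rewrite normr_gt0.
have N1 : \forall l \near l1, 0 < r l - `|x l1 - y0 l|.
  apply: near_gt0 => [|]; last by lra.
  by apply: cvgB => //; apply: cvg_norm; apply: cvgB => //; exact: cvg_cst.
(* This yields [|k l| * |x l1 - x l| <= |k l| / 2 * |x l1 - x l| + e * |k l| / 2], hence a distance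
   of at most [e]. *)
have N2 : \forall l \near l1, 0 < e * `|k l| / 2 - `|G l (x l1)|.
  apply: near_gt0.
    apply: cvgB; last by apply: cvg_norm; exact: cGl.
    apply: cvgM; last exact: cvg_cst.
    by apply: cvgM; [exact: cvg_cst | exact: cvg_norm].
  by rewrite Gx1 normr0 subr0 divr_gt0// mulr_gt0.
have N3 : \forall l \near l1, 0 < l.
  by apply: (near_gt0 id); [exact: cvg_id | case/andP: hl1].
have N4 : \forall l \near l1, 0 < l0 - l.
  apply: near_gt0; last by rewrite subr_gt0; case/andP: hl1.
  by apply: cvgB; [exact: cvg_cst | exact: cvg_id].
near=> l; have hl : 0 < l < l0.
  by rewrite -(subr_gt0 l l0); apply/andP; split; near: l.
have [Gx xy] := Hx _ hl; have [rl kl _ _ _] := Hrk _ hl.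
have h1 : `|x l1 - y0 l| <= r l by rewrite -subr_ge0 ltW//; near: l.
have h2 : `|G l (x l1)| <= e * `|k l| / 2 by rewrite -subr_ge0 ltW//; near: l.
have h3 : `|x l - y0 l| <= r l by lra.
have kl0 : 0 < `|k l| by rewrite normr_gt0.
have := dG l _ _ hl h3 h1; rewrite Gx subr0.
have : `|k l * (x l1 - x l)| <= `|G l (x l1) - k l * (x l1 - x l)| + `|G l (x l1)|.
  have E : G l (x l1) - k l * (x l1 - x l) - G l (x l1) = - (k l * (x l1 - x l)).
    by ring.
  have := ler_normB (G l (x l1) - k l * (x l1 - x l)) (G l (x l1)).
  by rewrite E normrN.
rewrite normrM => h4 h5; rewrite -(ler_pM2l kl0); lra.
Unshelve. all: by end_near. Qed.

(** [newton_branch] with centre [D * t], radius [M * t ^+ 2] and slope [k0 * t ^+ e]. *)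
Lemma scaled_branch (G : R -> R -> R) (t b : R -> R) (a A D k0 M0 K : R) (e : nat) :
  (e <= 1)%N -> k0 != 0 -> 0 <= M0 -> 0 <= K ->
  t l @[l --> (0 : R)^'+] --> 0 ->
  (\forall l \near (0 : R)^'+, 0 < t l) ->
  (\forall l \near (0 : R)^'+, {for l, continuous t}) ->
  (\forall l \near (0 : R)^'+, continuous (G l)) ->
  (\forall l \near (0 : R)^'+, forall y : R, {for l, continuous (G ^~ y)}) ->
  (\forall l \near (0 : R)^'+, forall y y' : R, `|y| <= (`|D| + 1) * t l ->
    `|y'| <= (`|D| + 1) * t l ->
    `|G l y' - G l y - (y' - y) * (a + A * (y + y') + b l)| <=
      K * t l ^+ 2 * `|y' - y|) ->
  (\forall l \near (0 : R)^'+,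
    `|a + 2 * A * (D * t l) + b l - k0 * t l ^+ e| <= M0 * t l ^+ e.+1) ->
  (\forall l \near (0 : R)^'+, `|G l (D * t l)| <= M0 * t l ^+ e.+2) ->
  exists (x : R -> R) (M : R), \forall l \near (0 : R)^'+,
    [/\ G l (x l) = 0, `|x l - D * t l| <= M * t l ^+ 2 & {for l, continuous x}].
Proof.
move=> e1 k00 M00 K0 t0 tp tc cGy cGl slope lin val.
have nk : 0 < `|k0| by rewrite normr_gt0.
(* [4 * M0 / |k0|] brings the residual [M0 * t ^+ e.+2] below a quarter of slope times radius; the
   added 1 keeps the radius positive. *)
pose M := 4 * M0 / `|k0| + 1.
have M1 : 1 <= M by rewrite lerDr divr_ge0// mulr_ge0.
(* Collects the slope errors: [2 * |A| * M] for moving both points within the radius, [M0] for the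
   slope at [D * t], [K] for the expansion. *)
pose K1 := 2 * `|A| * M + M0 + K.
have K10 : 0 <= K1 by rewrite !addr_ge0// mulr_ge0// ?mulr_ge0//; lra.
have tsmall (c : R) : 0 < c -> \forall l \near (0 : R)^'+, t l < c.
  by move=> c0; exact: (@cvgr_lt R R (0 : R)^'+ _ t 0 t0 c c0).
have T1 := tsmall 1 ltr01.
(* Gives [M * t ^+ 2 <= t], so the ball stays in the range [|y| <= (|D| + 1) * t] of the slope
   estimate. *)
have T2 : \forall l \near (0 : R)^'+, t l < M^-1.
  by apply: tsmall; rewrite invr_gt0; lra.
have T3 : \forall l \near (0 : R)^'+, t l < `|k0| / 2 / (K1 + 1).
  by apply: tsmall; rewrite !divr_gt0//; lra.
have /near0rP[l0 l00 H] : \forall l \near (0 : R)^'+,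
    [/\ [/\ 0 < t l, {for l, continuous t}, continuous (G l) &
          forall y : R, {for l, continuous (G ^~ y)}],
     [/\ t l < 1, t l < M^-1 & t l < `|k0| / 2 / (K1 + 1)] &
     [/\ forall y y' : R, `|y| <= (`|D| + 1) * t l ->
      `|y'| <= (`|D| + 1) * t l ->
    `|G l y' - G l y - (y' - y) * (a + A * (y + y') + b l)| <=
      K * t l ^+ 2 * `|y' - y|,
    `|a + 2 * A * (D * t l) + b l - k0 * t l ^+ e| <= M0 * t l ^+ e.+1 &
    `|G l (D * t l)| <= M0 * t l ^+ e.+2]].
  by near=> l; split; split; near: l.
(* Since [e] is at most 1, errors of size [t ^+ 2] are absorbed in [t * t ^+ e], of smaller order
   than the slope. *)
have te (l : R) : 0 < t l -> t l < 1 -> t l <= t l ^+ e.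
  by case: e e1 {lin val H} => [|[]]//; rewrite ?expr0 ?expr1 => _ _ /ltW.
have [|||||x Hx] := @newton_branch l0 G (fun l => D * t l)
  (fun l => M * t l ^+ 2) (fun l => k0 * t l ^+ e).
- move=> l /H[[tl ct _ _] _ _]; split.
  + by rewrite mulr_gt0 ?exprn_gt0//; lra.
  + by rewrite mulf_neq0// expf_neq0// gt_eqF.
  + by apply: cvgM ct; exact: cvg_cst.
  + by apply: cvgM; [exact: cvg_cst | rewrite expr2; exact: cvgM].
  + apply: cvgM; [exact: cvg_cst | move: e1; case: (e) => [|[]]//= _].
    exact: cvg_cst.
- by move=> l /H[[]].
- by move=> l y /H[[]].
- move=> l y y' /H[[tl _ _ _] [t1 tM tk] [sl ln _]] hy hy'.
  have {tM} tM : M * t l < 1 by rewrite mulrC -ltr_pdivlMr ?div1r//; lra.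
  have small (w : R) : `|w - D * t l| <= M * t l ^+ 2 -> `|w| <= (`|D| + 1) * t l.
    move=> hw; rewrite -(subrK (D * t l) w) (le_trans (ler_normD _ _))//.
    rewrite addrC normrM (gtr0_norm tl) mulrDl lerD2l mul1r (le_trans hw)//.
    by rewrite expr2 mulrA ler_piMl// ltW.
  have := sl _ _ (small _ hy) (small _ hy').
  set Y := `|y' - y|; set T := t l ^+ e; set dG := G l y' - G l y => h1.
  have T0 : 0 < T by rewrite exprn_gt0.
  have Y0 : 0 <= Y by exact: normr_ge0.
  have tT : t l <= T by exact: te.
  have h2 : `|a + A * (y + y') + b l - k0 * T| <= (2 * `|A| * M + M0) * (t l * T).
    have -> : a + A * (y + y') + b l - k0 * T =
      (a + 2 * A * (D * t l) + b l - k0 * T) +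
      A * ((y - D * t l) + (y' - D * t l)) by ring.
    rewrite (le_trans (ler_normD _ _))// [leRHS]mulrDl [leRHS]addrC lerD//.
      by rewrite -exprS.
    rewrite normrM -mulrA [2 * _]mulrC -!mulrA ler_wpM2l//.
    rewrite (le_trans (ler_normD _ _))// (le_trans (lerD hy hy'))//.
    suff : M * t l ^+ 2 <= M * (t l * T) by move=> ?; lra.
    by rewrite ler_wpM2l ?(le_trans ler01)// expr2 ler_pM2l.
  have -> : dG - k0 * T * (y' - y) = (dG - (y' - y) * (a + A * (y + y') + b l))
     + (y' - y) * (a + A * (y + y') + b l - k0 * T) by ring.
  rewrite (le_trans (ler_normD _ _))// (le_trans (lerD h1 (lexx _)))//.
  rewrite normrM -/Y [Y * _]mulrC -mulrDl ler_wpM2r//.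
  have h3 : K * t l ^+ 2 <= K * (t l * T) by rewrite ler_wpM2l// expr2 ler_pM2l.
  have h4 : K1 * t l <= `|k0| / 2.
    have K2 : 0 < K1 + 1 by lra.
    move: tk; rewrite ltr_pdivlMr// => /ltW; apply: le_trans.
    by rewrite mulrC ler_pM2l// lerDl.
  have : K1 * t l * T <= `|k0| / 2 * T by rewrite ler_wpM2r// ltW.
  rewrite normrM (gtr0_norm T0) /K1; move: h2 h3; lra.
- move=> l /H[[tl _ _ _] _ [_ _ /le_trans]]; apply.
  have T0 : 0 < t l ^+ e.+2 by rewrite exprn_gt0.
  rewrite normrM (@gtr0_norm _ (t l ^+ e)) ?exprn_gt0//.
  have -> : `|k0| * t l ^+ e * (M * t l ^+ 2) / 4 = `|k0| * M / 4 * t l ^+ e.+2.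
    by rewrite -[e.+2]addn2 exprD; ring.
  rewrite ler_wpM2r ?ltW//.
  have -> : `|k0| * M = 4 * M0 + `|k0| by rewrite /M; field; rewrite normr_eq0.
  lra.
by exists x, M; apply/near0rP; exists l0.
Unshelve. all: by end_near. Qed.

End Branch.

(** * Branches of one cell: regular, fold and transcritical *)

Section CellBranch.
Variables (R : realType) (n : nat) (f : 'rV[R]_(n + 1) -> R) (L : pred 'I_n).
Hypothesis Cf : Ck 3 f.
Hypothesis f0 : f 0 = 0.
Local Open Scope classical_set_scope.

Lemma continuous_rV m (v : R -> 'rV[R]_m) (l1 : R) :
  (forall j, {for l1, continuous (fun l => v l 0 j)}) -> {for l1, continuous v}.
Proof.
move=> H; apply/(@cvgrPdist_le R 'rV[R]_m R (nbhs l1) (nbhs_filter l1)) => e e0.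
have : \forall l \near l1, forall j, `|v l1 0 j - v l 0 j| <= e.
  apply: (@filter_forall _ _ (fun j l => `|v l1 0 j - v l 0 j| <= e)
    (nbhs l1) (nbhs_filter _)) => j.
  have cj := H j.
  by have /(@cvgrPdist_le R R R (nbhs l1) (nbhs_filter l1))/(_ e e0) := cj.
apply: (@filterS _ (nbhs l1) (nbhs_filter l1)) => l hl.
by apply: norm_le_coord => [|j]; [exact: ltW | rewrite !mxE].
Qed.

Lemma eq_continuous_for (F G : R -> R) (l1 : R) : F =1 G ->
  {for l1, continuous F} -> {for l1, continuous G}.
Proof. by move/funext->. Qed.

Lemma continuous_cell (y m : R -> R) (z : R -> 'I_n -> R) (l1 : R) :
  {for l1, continuous y} -> {for l1, continuous m} ->
  (forall i, ~~ L i -> {for l1, continuous (z ^~ i)}) ->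
  {for l1, continuous (fun l => f (cell_args L (y l) (z l) (m l)))}.
Proof.
move=> cy cm cz; have [cf _] := Cf.
apply: (@continuous_comp _ _ _ (fun l => cell_args L (y l) (z l) (m l)) f);
  last exact: cf.
apply: continuous_rV => j; rewrite -(splitK j).
case: (fintype.split j) => k; last first.
  by apply: eq_continuous_for cm => l; rewrite row_mxEr mxE.
apply: (eq_continuous_for (fun l => if L k then y l else z l k)).
  by move=> l; rewrite row_mxEl mxE.
by case E : (L k); [exact: cy | apply: cz; rewrite E].
Qed.

Definition mixed_bound : R := \sum_(j | ~~ L j) `|2 * \sum_(i | L i) fss f i j|
  + `|\sum_(i | L i) fsl f i|.

Lemma mixed_bound_ge0 : 0 <= mixed_bound.
Proof. by rewrite addr_ge0// sumr_ge0. Qed.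

Lemma norm_mixedL (z : 'I_n -> R) (l rho : R) :
  `|l| <= rho -> (forall i, ~~ L i -> `|z i| <= rho) ->
  `|mixedL f L z l| <= mixed_bound * rho.
Proof.
move=> hl hz; rewrite (le_trans (ler_normD _ _))// mulrDl lerD//.
  rewrite (le_trans (ler_norm_sum _ _ _))// mulr_suml ler_sum// => j Lj.
  by rewrite normrM mulrC ler_wpM2l// hz.
by rewrite normrM mulrC ler_wpM2l.
Qed.

Definition linear_bound : R := \sum_(i | ~~ L i) `|acoef f i| + `|ell f|.

Lemma linear_bound_ge0 : 0 <= linear_bound.
Proof. by rewrite addr_ge0// sumr_ge0. Qed.

Lemma norm_linear (w : 'I_n -> R) (l rho : R) :
  `|l| <= rho -> (forall i, ~~ L i -> `|w i| <= rho) ->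
  `|\sum_(i | ~~ L i) w i * acoef f i + l * ell f| <= linear_bound * rho.
Proof.
move=> hl hw; rewrite (le_trans (ler_normD _ _))// mulrDl lerD//.
  rewrite (le_trans (ler_norm_sum _ _ _))// mulr_suml ler_sum// => i Li.
  by rewrite normrM mulrC ler_wpM2l// hw.
by rewrite normrM mulrC ler_wpM2l.
Qed.

Variables (t : R -> R) (z : R -> 'I_n -> R).
Hypothesis t0 : t l @[l --> (0 : R)^'+] --> 0.
Hypothesis tp : \forall l \near (0 : R)^'+, 0 < t l.
Hypothesis tc : \forall l \near (0 : R)^'+, {for l, continuous t}.
Hypothesis zc : \forall l \near (0 : R)^'+,
  forall i, ~~ L i -> {for l, continuous (z ^~ i)}.

Lemma t_small (c : R) : 0 < c -> \forall l \near (0 : R)^'+, t l < c.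
Proof. by move=> c0; exact: (@cvgr_lt R R (0 : R)^'+ _ t 0 t0 c c0). Qed.

Lemma cell_branch (D k0 M0 M1 : R) (e : nat) :
  (e <= 1)%N -> k0 != 0 -> 0 <= M0 -> 0 <= M1 ->
  (\forall l \near (0 : R)^'+, `|l| <= M1 * t l) ->
  (\forall l \near (0 : R)^'+, forall i, ~~ L i -> `|z l i| <= M1 * t l) ->
  (\forall l \near (0 : R)^'+, `|aL f L + 2 * AL f L * (D * t l)
     + mixedL f L (z l) l - k0 * t l ^+ e| <= M0 * t l ^+ e.+1) ->
  (\forall l \near (0 : R)^'+,
     `|f (cell_args L (D * t l) (z l) l)| <= M0 * t l ^+ e.+2) ->
  exists (x : R -> R) (M : R), \forall l \near (0 : R)^'+,
    [/\ f (cell_args L (x l) (z l) l) = 0,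
        `|x l - D * t l| <= M * t l ^+ 2 & {for l, continuous x}].
Proof.
move=> e1 k00 M00 M10 hl hz hlin hval.
have [K K0 [dl dl0 slope]] := cell_slope _ _ f L Cf.
(* [c * t] bounds the trial states, the inputs and the parameter at once. *)
pose c := `|D| + 1 + M1.
have c0 : 0 < c by rewrite /c ltr_wpDr// ltr_wpDl.
apply: (@scaled_branch R (fun l y => f (cell_args L y (z l) l)) t
  (fun l => mixedL f L (z l) l) (aL f L) (AL f L) D k0 M0
  (K * c ^+ 2) e) => //.
- by rewrite mulr_ge0// exprn_ge0// ltW.
- near=> l => y; apply: (continuous_cell id (fun=> l) (fun=> z l)).
  + exact: cvg_id.
  + exact: cvg_cst.
  + by move=> i _; exact: cvg_cst.
- near=> l => y; apply: (continuous_cell (fun=> y) id z).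
  + exact: cvg_cst.
  + exact: cvg_id.
  + by near: l.
- have T1 : \forall l \near (0 : R)^'+, t l < dl / c.
    by apply: t_small; rewrite divr_gt0.
  near=> l => y y' hy hy'.
  have tl : 0 < t l by near: l.
  have cdl : c * t l <= dl by rewrite mulrC -ler_pdivlMr// ltW//; near: l.
  have le1 : (`|D| + 1) * t l <= c * t l by rewrite ler_pM2r// lerDl.
  have le2 : M1 * t l <= c * t l by rewrite ler_pM2r// lerDr addr_ge0.
  have hz' : forall i, ~~ L i -> `|z l i| <= M1 * t l by near: l.
  have := slope (c * t l) y y' (z l) l cdl (le_trans hy le1) (le_trans hy' le1).
  rewrite exprMn mulrA; apply; first by rewrite (le_trans _ le2)//; near: l.
  by move=> i /hz'/le_trans; apply.
Unshelve. all: by end_near. Qed.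

(** Non-critical case: the parameter and the inputs live on the scale [t] itself, the last
    hypothesis is the equation at order [t], and the slope is [aL], with [e = 0]. *)
Lemma regular_branch (d : 'I_n -> R) (dl M0 D : R) : aL f L != 0 -> 0 <= M0 ->
  (\forall l \near (0 : R)^'+, `|l - dl * t l| <= M0 * t l ^+ 2) ->
  (\forall l \near (0 : R)^'+, forall i, ~~ L i ->
     `|z l i - d i * t l| <= M0 * t l ^+ 2) ->
  D * aL f L + \sum_(i | ~~ L i) d i * acoef f i + dl * ell f = 0 ->
  exists (x : R -> R) (M : R), \forall l \near (0 : R)^'+,
    [/\ f (cell_args L (x l) (z l) l) = 0,
        `|x l - D * t l| <= M * t l ^+ 2 & {for l, continuous x}].
Proof.
move=> a0 M00 hl hz hD.
have [K K0 [del del0 lin]] := cell_linear _ _ f L Cf f0.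
pose M1 := \sum_i `|d i| + `|dl| + M0.
have M10 : 0 <= M1 by rewrite !addr_ge0// sumr_ge0.
have dM1 i : `|d i| + M0 <= M1.
  by rewrite lerD2r (bigD1 i)//= -addrA lerDl addr_ge0// sumr_ge0.
have dlM1 : `|dl| + M0 <= M1 by rewrite lerD2r lerDr sumr_ge0.
have bnd (w u c : R) : 0 < u <= 1 -> `|w - c * u| <= M0 * u ^+ 2 ->
    `|c| + M0 <= M1 -> `|w| <= M1 * u.
  move=> /andP[u0 u1] hw hc; rewrite -(subrK (c * u) w).
  rewrite (le_trans (ler_normD _ _))// (le_trans (lerD hw (lexx _)))//.
  rewrite normrM (gtr0_norm u0) (le_trans _ (ler_wpM2r (ltW u0) hc))//.
  by rewrite [leLHS]addrC mulrDl lerD2l expr2 mulrA ler_piMr// mulr_ge0// ltW.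
have T1 := t_small 1 ltr01.
have B1 : \forall l \near (0 : R)^'+, `|l| <= M1 * t l.
  near=> l; apply: (bnd l (t l) dl) => //; last by near: l.
  by apply/andP; split; [near: l | apply/ltW; near: l].
have B2 : \forall l \near (0 : R)^'+, forall i, ~~ L i -> `|z l i| <= M1 * t l.
  near=> l => i Li; apply: (bnd _ _ (d i)) => //.
    by apply/andP; split; [near: l | apply/ltW; near: l].
  by move: i Li; near: l.
pose c := `|D| + M1 + 1.
have c0 : 0 < c by rewrite ltr_wpDl// addr_ge0.
pose C1 := 2 * `|AL f L| * `|D| + mixed_bound * M1.
pose C2 := K * c ^+ 2 + linear_bound * M0.
have C10 : 0 <= C1 by rewrite addr_ge0// mulr_ge0// ?mulr_ge0// mixed_bound_ge0.
have C20 : 0 <= C2.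
  by rewrite addr_ge0// mulr_ge0// ?exprn_ge0 ?(ltW c0)// linear_bound_ge0.
apply: (cell_branch D (aL f L) (C1 + C2) M1 0) => //; first exact: addr_ge0.
- near=> l; have tl : 0 < t l by near: l.
  rewrite expr0 mulr1 expr1 (_ : _ - _ = 2 * AL f L * (D * t l)
     + mixedL f L (z l) l); last by ring.
  rewrite (le_trans (ler_normD _ _))// [leRHS]mulrDl ler_wpDr ?mulr_ge0 ?(ltW tl)//.
  rewrite /C1 [leRHS]mulrDl lerD//.
    by rewrite !normrM (gtr0_norm tl) normr_nat !mulrA.
  by rewrite -mulrA norm_mixedL//; near: l.
have T2 : \forall l \near (0 : R)^'+, t l < del / c.
  by apply: t_small; rewrite divr_gt0.
near=> l; have tl : 0 < t l by near: l.
have cdl : c * t l <= del by rewrite mulrC -ler_pdivlMr// ltW//; near: l.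
have le1 : `|D * t l| <= c * t l.
  by rewrite normrM (gtr0_norm tl) ler_pM2r// /c -addrA lerDl addr_ge0.
have le2 : M1 * t l <= c * t l by rewrite ler_pM2r// /c addrAC lerDr addr_ge0.
have hz1 : forall i, ~~ L i -> `|z l i| <= M1 * t l by near: l.
have hz2 : forall i, ~~ L i -> `|z l i - d i * t l| <= M0 * t l ^+ 2 by near: l.
have hl1 : `|l| <= M1 * t l by near: l.
have hl2 : `|l - dl * t l| <= M0 * t l ^+ 2 by near: l.
have h1 := lin _ _ (z l) l cdl le1 (le_trans hl1 le2)
  (fun i Li => le_trans (hz1 i Li) le2).
have h2 := norm_linear (fun i => z l i - d i * t l) _ _ hl2 hz2.
(* By [hD] the linear form vanishes at the leading coefficients, so only the O(t^2) deviations of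
   inputs and parameter remain. *)
have E : \sum_(i | ~~ L i) (z l i - d i * t l) * acoef f i + (l - dl * t l) * ell f
    = D * t l * aL f L + \sum_(i | ~~ L i) z l i * acoef f i + l * ell f.
  under eq_bigr do rewrite mulrBl mulrAC.
  rewrite sumrB -mulr_suml.
  have -> : D * t l * aL f L = t l * (D * aL f L) by ring.
  by move/eqP: hD; rewrite -addrA addr_eq0 => /eqP->; ring.
rewrite E in h2; rewrite -(subrK (D * t l * aL f L + \sum_(i | ~~ L i)
  z l i * acoef f i + l * ell f) (f _)) (le_trans (ler_normD _ _))//.
rewrite (le_trans (lerD h1 h2))//.
have -> : K * (c * t l) ^+ 2 + linear_bound * (M0 * t l ^+ 2) = C2 * t l ^+ 2.
  by rewrite /C2; ring.
by rewrite ler_wpM2r ?exprn_ge0 ?(ltW tl)// lerDr.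
Unshelve. all: by end_near. Qed.

(** Critical case: with no linear term in the state, inputs of size [t ^+ 2] balance
    [AL * (D * t) ^+ 2]. The slope [2 * AL * D * t] has exact order [t], so [e = 1]. *)
Lemma fold_branch (d : 'I_n -> R) (dl M0 D : R) :
  aL f L = 0 -> AL f L != 0 -> D != 0 -> 0 <= M0 ->
  (\forall l \near (0 : R)^'+, `|l - dl * t l ^+ 2| <= M0 * t l ^+ 3) ->
  (\forall l \near (0 : R)^'+, forall i, ~~ L i ->
     `|z l i - d i * t l ^+ 2| <= M0 * t l ^+ 3) ->
  AL f L * D ^+ 2 + \sum_(i | ~~ L i) d i * acoef f i + dl * ell f = 0 ->
  exists (x : R -> R) (M : R), \forall l \near (0 : R)^'+,
    [/\ f (cell_args L (x l) (z l) l) = 0,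
        `|x l - D * t l| <= M * t l ^+ 2 & {for l, continuous x}].
Proof.
move=> a0 A0 D0 M00 hl hz hD.
have [K K0 [del del0 lin]] := cell_linear _ _ f L Cf f0.
have [K' K'0 [del' del'0 slope]] := cell_slope _ _ f L Cf.
pose M1 : R := \sum_i `|d i| + `|dl| + M0.
have M10 : 0 <= M1 by rewrite !addr_ge0// sumr_ge0.
have dM1 i : `|d i| + M0 <= M1.
  by rewrite lerD2r (bigD1 i)//= -addrA lerDl addr_ge0// sumr_ge0.
have dlM1 : `|dl| + M0 <= M1 by rewrite lerD2r lerDr sumr_ge0.
have bnd (w u c : R) : 0 < u <= 1 -> `|w - c * u ^+ 2| <= M0 * u ^+ 3 ->
    `|c| + M0 <= M1 -> `|w| <= M1 * u ^+ 2.
  move=> /andP[u0 u1] hw hc; rewrite -(subrK (c * u ^+ 2) w).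
  have u20 : 0 < u ^+ 2 by rewrite exprn_gt0.
  rewrite (le_trans (ler_normD _ _))// (le_trans (lerD hw (lexx _)))//.
  rewrite normrM (gtr0_norm u20) (le_trans _ (ler_wpM2r (ltW u20) hc))//.
  by rewrite [leLHS]addrC mulrDl lerD2l exprS mulrCA ler_piMl// mulr_ge0// ltW.
have T1 := t_small 1 ltr01.
have B1 : \forall l \near (0 : R)^'+, `|l| <= M1 * t l ^+ 2.
  near=> l; apply: (bnd l (t l) dl) => //; last by near: l.
  by apply/andP; split; [near: l | apply/ltW; near: l].
have B2 : \forall l \near (0 : R)^'+, forall i, ~~ L i -> `|z l i| <= M1 * t l ^+ 2.
  near=> l => i Li; apply: (bnd _ _ (d i)) => //.
    by apply/andP; split; [near: l | apply/ltW; near: l].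
  by move: i Li; near: l.
have tt2 (l : R) : 0 < t l -> t l < 1 -> M1 * t l ^+ 2 <= M1 * t l.
  by move=> tl t1; rewrite ler_wpM2l// expr2 ler_piMl// ltW.
pose c : R := `|D| + M1 + 1.
have c0 : 0 < c by rewrite ltr_wpDl// addr_ge0.
pose C1 : R := mixed_bound * M1.
pose C2 : R := K' * c ^+ 2 * `|D| + K * M1 ^+ 2 + linear_bound * M0
  + `|D| * (mixed_bound * M1).
have C10 : 0 <= C1 by rewrite mulr_ge0// mixed_bound_ge0.
have C20 : 0 <= C2.
  by rewrite !addr_ge0// ?mulr_ge0// ?mulr_ge0// ?exprn_ge0 ?(ltW c0)//
    ?linear_bound_ge0 ?mixed_bound_ge0.
apply: (cell_branch D (2 * AL f L * D) (C1 + C2) M1 1) => //.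
- by rewrite mulf_neq0// mulf_neq0// pnatr_eq0.
- exact: addr_ge0.
- near=> l; apply: (@le_trans _ _ (M1 * t l ^+ 2)); first by near: l.
  by apply: tt2; near: l.
- near=> l => i Li; apply: (@le_trans _ _ (M1 * t l ^+ 2)).
    by move: i Li; near: l.
  by apply: tt2; near: l.
- near=> l; have tl : 0 < t l by near: l.
  rewrite a0 expr1 (_ : _ - _ = mixedL f L (z l) l); last by ring.
  rewrite (le_trans (norm_mixedL (z l) l (M1 * t l ^+ 2) _ _)); [by []| | |].
  + by near: l.
  + by near: l.
  + by rewrite mulrA ler_wpM2r ?exprn_ge0 ?(ltW tl)// lerDl.
have T2 : \forall l \near (0 : R)^'+, t l < del' / c.
  by apply: t_small; rewrite divr_gt0.
have T3 : \forall l \near (0 : R)^'+, t l < del / c.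
  by apply: t_small; rewrite divr_gt0.
near=> l; have tl : 0 < t l by near: l.
have t1 : t l < 1 by near: l.
have cdl : c * t l <= del by rewrite mulrC -ler_pdivlMr// ltW//; near: l.
have cdl' : c * t l <= del' by rewrite mulrC -ler_pdivlMr// ltW//; near: l.
have le1 : `|D * t l| <= c * t l.
  by rewrite normrM (gtr0_norm tl) ler_pM2r// /c -addrA lerDl addr_ge0.
have le2 : M1 * t l <= c * t l by rewrite ler_pM2r// /c addrAC lerDr addr_ge0.
have le3 := tt2 l tl t1.
have hz1 : forall i, ~~ L i -> `|z l i| <= M1 * t l ^+ 2 by near: l.
have hz2 : forall i, ~~ L i -> `|z l i - d i * t l ^+ 2| <= M0 * t l ^+ 3 by near: l.
have hl1 : `|l| <= M1 * t l ^+ 2 by near: l.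
have hl2 : `|l - dl * t l ^+ 2| <= M0 * t l ^+ 3 by near: l.
(* The state [D * t] is reached from the state 0: there the linear expansion has error O(t^4), and
   [slope] supplies the quadratic term, which a linear expansion at [D * t] would lose in its
   error. *)
have y0 : `|0 : R| <= M1 * t l ^+ 2 by rewrite normr0 mulr_ge0// exprn_ge0// ltW.
have h1 := lin _ _ (z l) l (le_trans le3 (le_trans le2 cdl)) y0 hl1 hz1.
have h2 := norm_linear (fun i => z l i - d i * t l ^+ 2) _ _ hl2 hz2.
have up w : w <= M1 * t l ^+ 2 -> w <= c * t l.
  by move=> hw; exact: le_trans hw (le_trans le3 le2).
have h3 := slope (c * t l) 0 (D * t l) (z l) l cdl' (up _ y0) le1 (up _ hl1)
  (fun i Li => up _ (hz1 i Li)).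
have h4 := norm_mixedL (z l) l _ hl1 hz1.
rewrite mul0r add0r in h1; rewrite a0 add0r add0r subr0 in h3.
have E : \sum_(i | ~~ L i) (z l i - d i * t l ^+ 2) * acoef f i
    + (l - dl * t l ^+ 2) * ell f
    = AL f L * D ^+ 2 * t l ^+ 2
      + (\sum_(i | ~~ L i) z l i * acoef f i + l * ell f).
  under eq_bigr do rewrite mulrBl mulrAC.
  rewrite sumrB -mulr_suml.
  by move/eqP: hD; rewrite -addrA addr_eq0 => /eqP->; ring.
rewrite E in h2; move: h1 h2 h3 h4.
set F := f (cell_args _ (D * t l) _ _); set F0 := f _.
set mx := mixedL _ _ _ _; set s := \sum_(i | _) _ + _; set A := AL _ _.
move=> h1 h2 h3 h4.
have -> : F = (F - F0 - D * t l * (A * (D * t l) + mx)) + (F0 - s)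
    + (A * D ^+ 2 * t l ^+ 2 + s) + D * t l * mx by ring.
have h5 : `|D * t l * mx| <= `|D| * t l * (mixed_bound * (M1 * t l ^+ 2)).
  by rewrite normrM [`|D * _|]normrM (gtr0_norm tl) ler_wpM2l// mulr_ge0// ltW.
rewrite normrM (gtr0_norm tl) in h3.
rewrite (le_trans (ler_normD _ _))// (le_trans (lerD (le_trans (ler_normD _ _)
  (lerD (le_trans (ler_normD _ _) (lerD h3 h1)) h2)) h5))//.
apply: (@le_trans _ _ (C2 * t l ^+ 3)); last first.
  by rewrite ler_wpM2r ?exprn_ge0 ?(ltW tl)// lerDr.
have t43 : t l ^+ 4 <= t l ^+ 3.
  by rewrite exprS ler_piMl ?exprn_ge0 ?ltW.
have : K * M1 ^+ 2 * t l ^+ 4 <= K * M1 ^+ 2 * t l ^+ 3.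
  by rewrite ler_wpM2l// mulr_ge0// exprn_ge0.
by rewrite /C2 => h; lra.
Unshelve. all: by end_near. Qed.

(** As [X] solves the equation, the value at [D * l] is an increment with factor [D * l - X l], and
    the last hypothesis cancels the other factor at order [l]. The same relation turns the slope at
    [D * l] into [AL * (D - X1) * l] up to O(l^2), with nonzero coefficient. *)
Lemma transcritical_branch (X : R -> R) (X1 M0 D : R) : (forall l, t l = l) ->
  (forall l i, ~~ L i -> z l i = X l) -> 0 <= M0 ->
  (\forall l \near (0 : R)^'+, `|X l - X1 * l| <= M0 * l ^+ 2) ->
  (\forall l \near (0 : R)^'+, f (cell_args L (X l) (z l) l) = 0) ->
  aL f L = 0 -> AL f L != 0 -> D != X1 ->
  AL f L * (D + X1) + 2 * (\sum_(i | L i) \sum_(j | ~~ L j) fss f i j) * X1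
    + \sum_(i | L i) fsl f i = 0 ->
  exists (x : R -> R) (M : R), \forall l \near (0 : R)^'+,
    [/\ f (cell_args L (x l) (z l) l) = 0,
        `|x l - D * t l| <= M * t l ^+ 2 & {for l, continuous x}].
Proof.
move=> ht hzX M00 hX fX a0 A0 DX hD.
have [K K0 [del del0 slope]] := cell_slope _ _ f L Cf.
set S := \sum_(i | _) \sum_(j | _) _ in hD; set F := \sum_(i | _) fsl f i in hD.
have mixE (l : R) : mixedL f L (z l) l = 2 * S * X l + l * F.
  rewrite /mixedL -/F; congr (_ + _).
  rewrite /S exchange_big [RHS]mulrC [2 * _]mulr_sumr [RHS]mulr_sumr.
  by apply: eq_bigr => j Lj; rewrite (hzX l _ Lj).
pose M1 : R := `|X1| + M0 + 1.
have M10 : 0 <= M1 by rewrite !addr_ge0.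
pose c : R := `|D| + M1 + 1.
have c0 : 0 < c by rewrite ltr_wpDl// addr_ge0.
have T1 := t_small 1 ltr01.
have BX : \forall l \near (0 : R)^'+, `|X l| <= M1 * t l.
  near=> l; have l0 : 0 < l by near: l; exact: nbhs_right_gt.
  have l1 : l < 1 by rewrite -(ht l); near: l.
  rewrite ht -(subrK (X1 * l) (X l)) (le_trans (ler_normD _ _))//.
  have h1 : `|X l - X1 * l| <= M0 * l ^+ 2 by near: l.
  rewrite (le_trans (lerD h1 (lexx _)))// normrM (gtr0_norm l0) /M1.
  have : M0 * l ^+ 2 <= M0 * l by rewrite ler_wpM2l// expr2 ler_piMl// ltW.
  move=> h2; rewrite !mulrDl; lra.
pose C1 : R := `|2 * S| * M0.
pose C2 : R := K * c ^+ 3 + c * (`|AL f L + 2 * S| * M0).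
have C10 : 0 <= C1 by rewrite mulr_ge0.
have C20 : 0 <= C2.
  by rewrite addr_ge0// mulr_ge0// ?mulr_ge0// ?exprn_ge0 ?(ltW c0).
apply: (cell_branch D (AL f L * (D - X1)) (C1 + C2) M1 1) => //.
- by rewrite mulf_neq0// subr_eq0.
- exact: addr_ge0.
- near=> l; have l0 : 0 < l by near: l; exact: nbhs_right_gt.
  by rewrite ht (gtr0_norm l0) ler_peMl ?(ltW l0)// lerDr addr_ge0.
- near=> l => i Li; rewrite hzX//; by near: l.
- near=> l; have l0 : 0 < l by near: l; exact: nbhs_right_gt.
  rewrite a0 expr1 mixE ht (_ : _ - _ = 2 * S * (X l - X1 * l)
    + l * (AL f L * (D + X1) + 2 * S * X1 + F)); last by ring.
  rewrite hD mulr0 addr0 normrM [leRHS]mulrDl ler_wpDr ?mulr_ge0 ?exprn_ge0 ?(ltW l0)//.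
  by rewrite /C1 -mulrA ler_wpM2l//; near: l.
have T2 : \forall l \near (0 : R)^'+, t l < del / c.
  by apply: t_small; rewrite divr_gt0.
near=> l; have l0 : 0 < l by near: l; exact: nbhs_right_gt.
have cdl : c * l <= del by rewrite mulrC -ler_pdivlMr// -{1}(ht l) ltW//; near: l.
have hX1 : `|X l| <= M1 * l by rewrite -{2}(ht l); near: l.
have hX2 : `|X l - X1 * l| <= M0 * l ^+ 2 by near: l.
have fX0 : f (cell_args L (X l) (z l) l) = 0 by near: l.
have le1 : `|D * l| <= c * l.
  by rewrite normrM (gtr0_norm l0) ler_pM2r// /c -addrA lerDl addr_ge0.
have le2 : M1 * l <= c * l by rewrite ler_pM2r// /c addrAC lerDr addr_ge0.
have le3 : `|l| <= c * l.
  by rewrite (gtr0_norm l0) ler_peMl ?(ltW l0)// lerDr addr_ge0.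
have hz1 i : ~~ L i -> `|z l i| <= c * l.
  by move=> Li; rewrite hzX// (le_trans hX1).
have h1 := slope (c * l) (X l) (D * l) (z l) l cdl (le_trans hX1 le2) le1 le3 hz1.
rewrite fX0 subr0 a0 add0r mixE in h1.
have h2 : `|D * l - X l| <= c * l.
  rewrite (le_trans (ler_normB _ _))// (le_trans (lerD (lexx _) hX1))//.
  by rewrite normrM (gtr0_norm l0) -mulrDl ler_pM2r// lerDl.
rewrite ht; set Fv := f _ in h1 *.
rewrite (_ : AL f L * _ + _ = (AL f L + 2 * S) * (X l - X1 * l)
    + l * (AL f L * (D + X1) + 2 * S * X1 + F)) in h1; last by ring.
rewrite hD mulr0 addr0 in h1.
have h3 : `|(D * l - X l) * ((AL f L + 2 * S) * (X l - X1 * l))| <=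
    c * l * (`|AL f L + 2 * S| * (M0 * l ^+ 2)).
  by rewrite normrM ler_pM// normrM ler_wpM2l.
have h4 : K * (c * l) ^+ 2 * `|D * l - X l| <= K * (c * l) ^+ 2 * (c * l).
  by rewrite ler_wpM2l// mulr_ge0// exprn_ge0// mulr_ge0// ltW.
rewrite -(subrK ((D * l - X l) * ((AL f L + 2 * S) * (X l - X1 * l))) Fv).
rewrite (le_trans (ler_normD _ _))// (le_trans (lerD (le_trans h1 h4) h3))//.
apply: (@le_trans _ _ (C2 * l ^+ 3)); last first.
  by rewrite ler_wpM2r ?exprn_ge0 ?(ltW l0)// lerDr.
by rewrite le_eqVlt; apply/orP; left; apply/eqP; rewrite /C2; ring.
Unshelve. all: by end_near. Qed.

End CellBranch.

(** * The fractional scales of the parameter *)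

Section Powers.
Variable R : realType.
Implicit Types l : R.
Local Open Scope classical_set_scope.

Definition scale (m : nat) l : R := l `^ (2 ^- m).

Lemma scale0 l : 0 < l -> scale 0 l = l.
Proof. by move=> l0; rewrite /scale expr0 invr1 powRr1// ltW. Qed.

Lemma scale_gt0 m l : 0 < l -> 0 < scale m l.
Proof. exact: powR_gt0. Qed.

(** The passage through a fold: inputs at [scale m] produce a state at its square root. *)
Lemma scaleS_sqr m l : scale m.+1 l ^+ 2 = scale m l.
Proof.
rewrite -powR_mulrn ?powR_ge0// -powRrM; congr (_ `^ _).
by rewrite exprSr invfM divfK// pnatr_eq0.
Qed.

Lemma scale_sqr m l : scale m l ^+ 2 = l `^ (2 * 2 ^- m).
Proof. by rewrite -powR_mulrn ?powR_ge0// -powRrM mulrC. Qed.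

Lemma scale_le m m' l : 0 < l <= 1 -> (m <= m')%N -> scale m l <= scale m' l.
Proof.
move=> l01 mm'; apply: ger_powR => //; rewrite lef_pV2 ?posrE ?exprn_gt0//.
by rewrite ler_eXn2l// ltr1n.
Qed.

Lemma scale_le1 m l : 0 < l <= 1 -> scale m l <= 1.
Proof.
by move=> l01; rewrite -[leRHS](powRr0 l); apply: ger_powR.
Qed.

Lemma scale_cvg0 m : scale m l @[l --> (0 : R)^'+] --> 0.
Proof. by apply: powR_cvg0; rewrite invr_gt0 exprn_gt0. Qed.

Lemma continuous_scale m l : 0 < l -> {for l, continuous (scale m)}.
Proof.
move=> l0; apply: differentiable_continuous; apply/derivable1_diffP.
by apply: derivable_powR; rewrite in_itv /= l0.
Qed.

Lemma near0r_gt0 : \forall l \near (0 : R)^'+, 0 < l.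
Proof. exact: nbhs_right_gt. Qed.

Lemma near0r_le1 : \forall l \near (0 : R)^'+, 0 < l <= 1.
Proof. by apply/near0rP; exists 1 => // l /andP[-> /ltW->]. Qed.

Lemma near_scale_gt0 m : \forall l \near (0 : R)^'+, 0 < scale m l.
Proof. by apply/near0rP; exists 1 => // l /andP[? _]; exact: scale_gt0. Qed.

Lemma near_continuous_scale m :
  \forall l \near (0 : R)^'+, {for l, continuous (scale m)}.
Proof. by apply/near0rP; exists 1 => // l /andP[? _]; exact: continuous_scale. Qed.

End Powers.

(** * Induction over the cells of the network *)

Section Assembly.
Variables (R : realType) (C : finType) (n : nat) (sig : 'I_n -> C -> C).
Variables (f : 'rV[R]_(n + 1) -> R) (B : {set C}) (D : C -> R).
Hypotheses (ff : feedforward sig) (Cf : Ck 3 f) (f0 : f 0 = 0).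
Hypothesis K0 : Kc f != 0.
Hypothesis rB : root_subnetwork sig (critical sig f) B.
Hypothesis DB : Dcoeffs sig f B D.
Local Open Scope classical_set_scope.
Local Notation muB := (mu sig (critical sig f) B).
Local Notation scale := (scale R).

(** In full synchrony all cells share one equation, that of a cell with only self-inputs;
    [regular_branch] applies with [L = predT], slope [Kc f] and a dummy [z]. *)
Lemma synchronous_branch : exists (X : R -> R) (M : R), 0 <= M /\
  \forall l \near (0 : R)^'+, [/\ forall p, gamma sig f (fun=> X l) l p = 0,
    `|X l - - ell f / Kc f * l| <= M * l ^+ 2 & {for l, continuous X}].
Proof.
have aT : aL f predT = Kc f by [].
have zc : \forall l \near (0 : R)^'+, forall i : 'I_n, ~~ predT i ->
    {for l, continuous ((fun (_ : R) (_ : 'I_n) => 0 : R) ^~ i)}.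
  by near=> l => i.
have hl : \forall l \near (0 : R)^'+, `|l - 1 * scale 0 l| <= 0 * scale 0 l ^+ 2.
  near=> l; have l0 : 0 < l by near: l; exact: near0r_gt0.
  by rewrite scale0// mul1r subrr normr0 mul0r.
have hz : \forall l \near (0 : R)^'+, forall i : 'I_n, ~~ predT i ->
    `|0 - 0 * scale 0 l| <= 0 * scale 0 l ^+ 2.
  by near=> l.
have hD : - ell f / Kc f * aL f predT
    + \sum_(i | ~~ predT i) 0 * acoef f i + 1 * ell f = 0.
  by rewrite big1 => [|//]; rewrite aT divfK// mul1r addr0 addNr.
have [x [M H]] := @regular_branch R n f predT Cf f0 (scale 0)
    (fun _ _ => 0) (scale_cvg0 R 0) (near_scale_gt0 R 0)
    (near_continuous_scale R 0) zc (fun=> 0) 1 0 _ K0 (lexx 0) hl hz hD.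
exists x, `|M|; split; first exact: normr_ge0.
near=> l; have l0 : 0 < l by near: l; exact: near0r_gt0.
have [fx xM cx] : [/\ f (cell_args predT (x l) (fun=> 0) l) = 0,
    `|x l - - ell f / Kc f * scale 0 l| <= M * scale 0 l ^+ 2
    & {for l, continuous x}] by near: l.
split => //; move: xM; rewrite scale0// => /le_trans; apply.
by rewrite ler_wpM2r ?exprn_ge0 ?(ltW l0)// ler_norm.
Unshelve. all: by end_near. Qed.

Variables (X : R -> R) (MX : R).
Hypothesis MX0 : 0 <= MX.
Hypothesis HX : \forall l \near (0 : R)^'+,
  [/\ forall p, gamma sig f (fun=> X l) l p = 0,
    `|X l - - ell f / Kc f * l| <= MX * l ^+ 2 & {for l, continuous X}].

(** Induction invariant, [S] being the set of cells solved so far. Agreement with [X] on [B] is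
    exact and for all [l], as synchrony and [transcritical_branch] demand. *)
Definition partial_branch (S : {set C}) (x : R -> C -> R) : Prop :=
  (forall l p, p \in B -> x l p = X l) /\
  exists M : R, 0 <= M /\ \forall l \near (0 : R)^'+, forall p, p \in S ->
    [/\ gamma sig f (x l) l p = 0, {for l, continuous (x ^~ p)} &
      `|x l p - D p * scale (muB p) l| <= M * scale (muB p) l ^+ 2].

Lemma partial_branch_B : partial_branch B (fun l _ => X l).
Proof.
split=> //; exists MX; split=> //; near=> l => p pB.
have l0 : 0 < l by near: l; exact: near0r_gt0.
have [HX1 HX2 HX3] : [/\ forall p, gamma sig f (fun=> X l) l p = 0,
    `|X l - - ell f / Kc f * l| <= MX * l ^+ 2 & {for l, continuous X}] by near: l.
split => //; rewrite /mu pB scale0//.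
by have [_ [/(_ pB)-> _]] := DB p.
Unshelve. all: by end_near. Qed.

Section NextCell.
Variables (S : {set C}) (x : R -> C -> R) (p : C).
Hypothesis px : partial_branch S x.
Hypothesis pB : p \notin B.
Hypothesis pS : forall i, sig i p != p -> sig i p \in S.

Let L := Lp sig p.
(** By [max_mu] this is the largest [mu] above [p], so [scale m] is the scale of the inputs. In [d]
    and [dl] below, inputs of smaller [mu], and the parameter unless [m = 0], get leading
    coefficient 0. *)
Let m := (muB p - critical sig f p)%N.
Let d i : R := if muB (sig i p) == m then D (sig i p) else 0.
Let dl : R := (m == 0%N)%:R.

(** An input with [mu] below [m] is O([scale (m - 1)]), which is O([scale m ^+ 2]) and so belongs to
    the error; the same holds for the parameter when [m] is positive. *)
Lemma inputs_estimate : exists M : R, [/\ 0 <= M,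
  \forall l \near (0 : R)^'+, `|l - dl * scale m l| <= M * scale m l ^+ 2 &
  \forall l \near (0 : R)^'+, forall i, ~~ L i ->
    `|x l (sig i p) - d i * scale m l| <= M * scale m l ^+ 2].
Proof.
have [_ [M [M0 H]]] := px.
pose M1 : R := M + \sum_q `|D q| + 1.
have M10 : 0 <= M1 by rewrite !addr_ge0// sumr_ge0.
exists M1; split=> //.
  near=> l; have l01 : 0 < l <= 1 by near: l; exact: near0r_le1.
  have /andP[l0 l1] := l01.
  rewrite /dl; case: (m) => [|k].
    by rewrite scale0// mul1r subrr normr0 mulr_ge0// exprn_ge0// ltW.
  rewrite mul0r subr0 scaleS_sqr gtr0_norm//.
  rewrite (@le_trans _ _ (scale k l))//.
    by rewrite -{1}(scale0 _ _ l0) scale_le.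
  rewrite ler_peMl ?(ltW (scale_gt0 _ _ _ l0))// lerDr addr_ge0// sumr_ge0//.
near=> l => i Li; have l01 : 0 < l <= 1 by near: l; exact: near0r_le1.
have /andP[l0 l1] := l01.
have Hl : forall p, p \in S -> [/\ gamma sig f (x l) l p = 0,
    {for l, continuous (x ^~ p)} &
    `|x l p - D p * scale (muB p) l| <= M * scale (muB p) l ^+ 2] by near: l.
have [_ _ xM] := Hl _ (pS i Li).
have := mu_input _ _ _ ff _ _ rB p i pB Li; rewrite -/m /d.
have [mq _|mq|<- _] := ltngtP (muB (sig i p)) m; [|by []|]; last first.
  rewrite (le_trans xM)// ler_wpM2r ?exprn_ge0 ?(ltW (scale_gt0 _ _ _ l0))//.
  by rewrite /M1 -addrA lerDl addr_ge0// sumr_ge0.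
rewrite mul0r subr0; move: mq; case: (m) => // k; rewrite ltnS => mq.
rewrite scaleS_sqr -(subrK (D (sig i p) * scale (muB (sig i p)) l) (x l _)).
rewrite (le_trans (ler_normD _ _))// (le_trans (lerD xM (lexx _)))//.
have s0 := scale_gt0 _ (muB (sig i p)) _ l0.
have s1 := scale_le1 _ (muB (sig i p)) _ l01.
have sk := scale_le _ _ _ _ l01 mq.
rewrite normrM (gtr0_norm s0) (@le_trans _ _ (M1 * scale (muB (sig i p)) l))//;
  last by rewrite ler_wpM2l.
rewrite /M1 [leRHS]mulrDl [in leRHS]mulrDl ler_wpDr ?mul1r ?(ltW s0)// lerD//.
  by rewrite ler_wpM2l// expr2 ler_piMl// ltW.
rewrite ler_wpM2r ?(ltW s0)// (bigD1 (sig i p))//= lerDl sumr_ge0//.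
Unshelve. all: by end_near. Qed.

(** All inputs then have [mu = 0] and share the scale of the parameter, so every term of the rule
    survives. *)
Lemma sum_d0 : m = 0%N -> \sum_(i | ~~ L i) d i * acoef f i + dl * ell f =
  \sum_(i | ~~ L i) acoef f i * D (sig i p) + ell f.
Proof.
move=> m0; rewrite /dl m0 mul1r; congr (_ + _); apply: eq_bigr => i Li.
have := mu_input _ _ _ ff _ _ rB p i pB Li; rewrite -/m m0 leqn0 => mq.
by rewrite /d m0 mq mulrC.
Qed.

(** Only inputs in [Qp] reach the leading scale, and the parameter is of higher order. *)
Lemma sum_dS : (0 < m)%N -> \sum_(i | ~~ L i) d i * acoef f i + dl * ell f =
  \sum_(i | Qp sig (critical sig f) B p (sig i p)) acoef f i * D (sig i p).
Proof.
move=> m0; rewrite /dl gtn_eqF// mul0r addr0.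
under [RHS]eq_bigl => i do rewrite (Qp_input _ _ _ ff _ _ rB)//.
rewrite big_mkcondr /=; apply: eq_bigr => i Li.
by rewrite /d -/m; case: ifP => _; rewrite ?mul0r// mulrC.
Qed.

Lemma next_cell : exists (xp : R -> R) (M : R), \forall l \near (0 : R)^'+,
  [/\ f (cell_args L (xp l) (fun i => x l (sig i p)) l) = 0,
      `|xp l - D p * scale (muB p) l| <= M * scale (muB p) l ^+ 2
      & {for l, continuous xp}].
Proof.
have [M1 [M10 hl hz]] := inputs_estimate.
have [xX [M [M0 H]]] := px.
have zc : \forall l \near (0 : R)^'+,
    forall i, ~~ L i -> {for l, continuous (fun l => x l (sig i p))}.
  near=> l => i Li.
  have Hl : forall p, p \in S -> [/\ gamma sig f (x l) l p = 0,
    {for l, continuous (x ^~ p)} &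
    `|x l p - D p * scale (muB p) l| <= M * scale (muB p) l ^+ 2] by near: l.
  by have [] := Hl _ (pS i Li).
have [D0 [_ [Dn0 [DnS [Dc0 [Dc1 DcS]]]]]] := DB p.
have [cp|ncp] := boolP (critical sig f p); last first.
  (* Non-critical: the state lives on the scale of the inputs. *)
  have mE : m = muB p by rewrite /m (negbTE ncp) subn0.
  rewrite -mE; apply: (@regular_branch R n f L Cf f0 (scale m)
    (fun l i => x l (sig i p)) (scale_cvg0 R m) (near_scale_gt0 R m)
    (near_continuous_scale R m) zc d dl M1) => //.
  rewrite -addrA; apply/eqP; rewrite addr_eq0; apply/eqP.
  have [m0|m0] := posnP m.
    by rewrite sum_d0// Dn0// ?mE -?mE// divfK.
  by rewrite sum_dS// DnS// -?mE// divfK.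
have aL0 : aL f L = 0 by apply/eqP.
have [mu0|mu0] := posnP (muB p).
  have [A0 DE] := Dc0 pB cp mu0; move/eqP: A0 => A0.
  rewrite mu0.
  (* Critical with [mu = 0]: all proper inputs lie in [B], so [X] is one solution and [D p]
     describes the other, unless it is the coefficient of [X]. *)
  have zX l i : ~~ L i -> x l (sig i p) = X l.
    by move=> Li; apply/xX/(crit_mu0_inputs _ _ _ ff _ _ rB p i pB cp mu0 Li).
  have [DX|DX] := eqVneq (D p) (- ell f / Kc f).
    exists X, MX; near=> l; have l0 : 0 < l by near: l; exact: near0r_gt0.
    have [HX1 HX2 HX3] : [/\ forall p, gamma sig f (fun=> X l) l p = 0,
      `|X l - - ell f / Kc f * l| <= MX * l ^+ 2
      & {for l, continuous X}] by near: l.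
    rewrite DX scale0//; split => //; rewrite -[RHS](HX1 p); congr f.
    rewrite /fargs /cell_args; congr row_mx; apply/rowP => i; rewrite !mxE.
    by case: ifPn => // /zX.
  have id0 : id l @[l --> (0 : R)^'+] --> (0 : R).
    by apply: cvg_at_right_filter; exact: cvg_id.
  have idc : \forall l \near (0 : R)^'+, {for l, continuous (@id R)}.
    by near=> l; exact: cvg_id.
  have hX : \forall l \near (0 : R)^'+, `|X l - - ell f / Kc f * l| <= MX * l ^+ 2.
    by near=> l; have [] : [/\ forall p, gamma sig f (fun=> X l) l p = 0,
      `|X l - - ell f / Kc f * l| <= MX * l ^+ 2
      & {for l, continuous X}] by near: l.
  have fX : \forall l \near (0 : R)^'+,
      f (cell_args L (X l) (fun i => x l (sig i p)) l) = 0.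
    near=> l; have [HX1 _ _] : [/\ forall p, gamma sig f (fun=> X l) l p = 0,
      `|X l - - ell f / Kc f * l| <= MX * l ^+ 2
      & {for l, continuous X}] by near: l.
    rewrite -[RHS](HX1 p); congr f.
    rewrite /fargs /cell_args; congr row_mx; apply/rowP => i; rewrite !mxE.
    by case: ifPn => // /zX.
  have hD : AL f L * (D p + - ell f / Kc f)
      + 2 * (\sum_(i | L i) \sum_(j | ~~ L j) fss f i j) * (- ell f / Kc f)
      + \sum_(i | L i) fsl f i = 0.
    by rewrite DE /AL -/(Acoef sig f p) /L; field; rewrite K0 A0.
  have [xp [Mp Hp]] := @transcritical_branch R n f L Cf id
    (fun l i => x l (sig i p)) id0 (near0r_gt0 R) idc zc X (- ell f / Kc f) MX (D p)
    (fun=> erefl) zX MX0 hX fX aL0 A0 DX hD.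
  exists xp, Mp; near=> l; have l0 : 0 < l by near: l; exact: near0r_gt0.
  by rewrite scale0//; near: l.
(* Critical with positive [mu]: the state lives on the square root of the input scale. *)
have mE : muB p = m.+1 by rewrite /m cp subn1 prednK.
(* Division by 0 gives 0, so a strictly negative quotient forces a nonzero denominator. *)
have A_neq0 (u : R) : u / Acoef sig f p < 0 -> AL f L != 0.
  by apply: contraTneq => A0; rewrite /Acoef -/(AL f L) A0 invr0 mulr0 ltxx.
have sqrtE (u : R) : u / Acoef sig f p < 0 /\
    (D p = Num.sqrt (- (u / Acoef sig f p)) \/
     D p = - Num.sqrt (- (u / Acoef sig f p))) ->
    AL f L != 0 /\ AL f L * D p ^+ 2 + u = 0.
  move=> [uA DE]; have A0 := A_neq0 _ uA; split=> //.
  have -> : D p ^+ 2 = - (u / Acoef sig f p).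
    by case: DE => ->; rewrite ?sqrrN sqr_sqrtr// oppr_ge0 ltW.
  by rewrite mulrN [_ * (u / _)]mulrC divfK// addNr.
have [A0 hD] : AL f L != 0 /\
    AL f L * D p ^+ 2 + (\sum_(i | ~~ L i) d i * acoef f i + dl * ell f) = 0.
  have [m0|m0] := posnP m; [rewrite sum_d0// | rewrite sum_dS//]; apply: sqrtE.
    by apply: Dc1 => //; rewrite mE m0.
  by apply: DcS => //; rewrite mE ltnS.
(* With [t = scale m.+1] the input error [scale m ^+ 2] is [t ^+ 4], better than the [t ^+ 3] asked
   for by [fold_branch]. *)
have up (l : R) (u : R) : 0 < l <= 1 -> u <= M1 * scale m l ^+ 2 ->
    u <= M1 * scale m.+1 l ^+ 3.
  move=> l01; have /andP[l0 l1] := l01; move/le_trans; apply.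
  have s0 := scale_gt0 _ m.+1 _ l0; have s1 := scale_le1 _ m.+1 _ l01.
  by rewrite -scaleS_sqr ler_wpM2l// -exprM (exprS _ 3) ler_piMl ?exprn_ge0 ?(ltW s0).
rewrite mE; apply: (@fold_branch R n f L Cf f0 (scale m.+1)
    (fun l i => x l (sig i p)) (scale_cvg0 R m.+1) (near_scale_gt0 R m.+1)
    (near_continuous_scale R m.+1) zc d dl M1) => //.
- exact/eqP.
- near=> l; rewrite scaleS_sqr; apply: up; last by near: l.
  by near: l; exact: near0r_le1.
- near=> l => i Li; rewrite scaleS_sqr; apply: up.
    by near: l; exact: near0r_le1.
  by move: i Li; near: l.
- by rewrite -addrA.
Unshelve. all: by end_near. Qed.

Hypothesis clS : forall i q, q \in S -> sig i q \in S.
Hypothesis npS : p \notin S.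

(** Since [S] is closed under inputs and misses [p], changing the state of [p] leaves the equations
    on [S] intact. *)
Lemma extend_branch : exists x' : R -> C -> R, partial_branch (p |: S)%SET x'.
Proof.
have [xp [Mp Hp]] := next_cell; have [xX [M [M0 H]]] := px.
exists (fun l q => if q == p then xp l else x l q); split.
  by move=> l q qB; case: eqP => [qp|_]; [case/negP: pB; rewrite -qp | exact: xX].
exists (M + `|Mp|); split; first exact: addr_ge0.
near=> l => q; have l0 : 0 < l by near: l; exact: near0r_gt0.
have Hl : forall q, q \in S -> [/\ gamma sig f (x l) l q = 0,
    {for l, continuous (x ^~ q)} &
    `|x l q - D q * scale (muB q) l| <= M * scale (muB q) l ^+ 2] by near: l.
have [fxp xpM cxp] : [/\ f (cell_args L (xp l) (fun i => x l (sig i p)) l) = 0,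
      `|xp l - D p * scale (muB p) l| <= Mp * scale (muB p) l ^+ 2
      & {for l, continuous xp}] by near: l.
have s0 k : 0 <= scale k l ^+ 2 by rewrite exprn_ge0// ltW// scale_gt0.
rewrite !inE => /predU1P[->|qS].
  rewrite eqxx; split=> //.
  by rewrite (le_trans xpM)// ler_wpM2r// (le_trans (ler_norm _))// lerDr.
have [gq cq xq] := Hl q qS.
have qp : (q == p) = false by apply: contraNF npS => /eqP<-.
rewrite qp; split => //.
  rewrite -[RHS]gq /gamma; congr f; congr row_mx; apply/rowP => i; rewrite !mxE.
  by case: eqP => // sp; have := clS i q qS; rewrite sp (negbTE npS).
by rewrite (le_trans xq)// ler_wpM2r// lerDl.
Unshelve. all: by end_near. Qed.

End NextCell.

(** Induction on the size of the complement of [S]. The cell given by [exists_next] has all inputs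
    in [S] or equal to itself, so the enlarged set is again closed under inputs. *)
Lemma full_branch : exists x : R -> C -> R, partial_branch [set: C]%SET x.
Proof.
have [[_ clB] _ _ _] := rB.
suff H k : forall (S : {set C}) x, (#|~: S| <= k)%N -> B \subset S ->
    (forall i q, q \in S -> sig i q \in S) -> partial_branch S x ->
    exists x' : R -> C -> R, partial_branch [set: C]%SET x'.
  exact: (H _ B _ (leqnn _) _ clB partial_branch_B).
elim: k => [|k IH] S x kS BS clS px.
  exists x; suff <- : S = [set: C]%SET by [].
  apply/setP => q; rewrite inE; apply: contraT => nq.
  have : q \in (~: S)%SET by rewrite inE.
  by move: kS; rewrite leqn0 cards_eq0 => /eqP->; rewrite inE.
have [/eqP S0|] := boolP (S == [set: C]%SET); first by exists x; rewrite -S0.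
rewrite -finset.subTset => /fintype.subsetPn[q _ nq].
have [p npS pS] := exists_next _ _ _ ff S (ex_intro _ q nq).
have npB : p \notin B by apply: contraNN npS; apply/fintype.subsetP.
have [x' px'] := extend_branch S x p px npB pS clS npS.
apply: (IH (p |: S)%SET x' _ _ _ px').
- rewrite -ltnS (leq_trans _ kS)//; apply: proper_card.
  rewrite finset.setCU finset.properEneq; apply/andP; split.
    apply/eqP => /setP/(_ p); rewrite !inE eqxx npS.
    by [].
  exact: finset.subsetIr.
- by rewrite (fintype.subset_trans BS)// finset.subsetUr.
- move=> i r; rewrite !inE => /predU1P[->|rS]; last by rewrite clS ?orbT.
  by have [->|nip] := eqVneq (sig i p) p; rewrite ?eqxx// pS ?orbT.
Qed.

End Assembly.

Theorem theorem4p20 (R : realType) (C : finType) (n : nat)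
  (sig : 'I_n -> C -> C) (sig0 : 'I_n) (f : 'rV[R]_(n + 1) -> R)
  (B : {set C}) (D : C -> R) :
  injective sig -> sig sig0 = id -> feedforward sig ->
  smooth f -> assumptionB sig f ->
  (forall p, critical sig f p -> ~ maximal sig p) ->
  root_subnetwork sig (critical sig f) B ->
  Dcoeffs sig f B D ->
  exists l0 : R, 0 < l0 /\
  exists (x : R -> C -> R) (M : R),
    forall lam : R, 0 < lam < l0 ->
      (forall p, gamma sig f (x lam) lam p = 0) /\
      (forall p, {for lam, continuous (fun l => x l p)}) /\
      (forall p q, p \in B -> q \in B -> x lam p = x lam q) /\
      (forall p, p \in B -> `|x lam p - D p * lam| <= M * lam ^+ 2) /\
      (forall p, p \notin B ->
         `|x lam p - D p * lam `^ (2 ^- mu sig (critical sig f) B p)|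
           <= M * lam `^ (2 * 2 ^- mu sig (critical sig f) B p)).
Proof.
move=> _ _ ff smf [f0 [p0 _] _] critN rB DB; have Cf := smf 3%N.
(* A cell all of whose inputs are itself is maximal, hence not critical; its sum over self-inputs is
   the full sum [Kc f], which is therefore nonzero. *)
have [p _ pfix] : exists2 p, p \notin finset.set0 & forall i,
    sig i p != p -> sig i p \in finset.set0.
  by apply: exists_next => //; exists p0; rewrite inE.
have {}pfix i : sig i p = p.
  by apply/eqP; apply: contraT => /pfix; rewrite inE.
have K0 : Kc f != 0.
  have : ~~ critical sig f p by apply/negP => /critN; apply; exact: fixed_maximal.
  rewrite /critical (eq_bigl xpredT)// => i.
  by rewrite /Lp pfix eqxx.
have [X [MX [MX0 HX]]] := synchronous_branch R C n sig f Cf f0 K0.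
have [x [xX [M [M0 /near0rP[l0 l00 H]]]]] :=
  full_branch R C n sig f B D ff Cf f0 K0 rB DB X MX MX0 HX.
exists l0; split=> //; exists x, M => lam hlam.
have {}H q := H lam hlam q (finset.in_setT q); have /andP[lam0 _] := hlam.
split; [|split; [|split; [|split]]].
- by move=> q; have [] := H q.
- by move=> q; have [] := H q.
- by move=> q r qB rB'; rewrite !xX.
- by move=> q qB; have [_ _] := H q; rewrite /mu qB scale0.
- by move=> q _; have [_ _] := H q; rewrite scale_sqr.
Qed.
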